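(* For every finite graph $G$, $\bar\kappa(G;x,y)=R_G(x,y)$ as polynomials; equivalently, for all nonnegative integers $p,q$, $R_G(p,q)$ equals the number of triples $(\rho,f,g)$ where $\rho$ runs over a set of distinct representatives of the cut-Eulerian equivalence classes of $\mathcal O(G)$, $f$ is an integer-valued tension of $(G,\rho)$ with $0\le f(e)\le p$ for all $e$, and $g$ is an integer-valued flow of $(G,\rho)$ with $0\le g(e)\le q$ for all $e$.
   Context: $G=(V,E)$ is a finite graph, loops and multiple edges allowed; $c(\cdot)$ counts connected components; for $X\subseteq E$, $r(X)=|V|-c((V,X))$, $n(X)=|X|-r(X)$. Whitney's rank generating polynomial is $R_G(x,y)=\sum_{X\subseteq E}x^{r(E)-r(X)}y^{n(X)}$. An orientation chooses for each edge one of its two directions (loops also have two); $\mathcal O(G)$ is the set of orientations; $E(\rho\ne\sigma)$ is the set of edges where $\rho,\sigma$ differ. An integer flow $g$ of $(G,\rho)$ is $g:E\to\mathbb Z$ with, at each vertex, the sum over incoming edges equal to the sum over outgoing edges; an integer tension is $f:E\to\mathbb Z$ with $f(e)=h(u)-h(v)$ for each edge directed from $u$ to $v$, for some $h:V\to\mathbb Z$. A bond is a minimal nonempty edge set $[S,V\setminus S]$, directed if all its edges point the same way across. A locally directed cut is an edge set $[S,V\setminus S]$ with an orientation making it a disjoint union of directed bonds; a directed Eulerian subgraph is an edge set with an orientation having equal in- and out-degree at each vertex. $\rho\sim_{ce}\sigma$ (cut-Eulerian equivalent) if $E(\rho\ne\sigma)$, oriented by $\rho$, is a disjoint union of a locally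 directed cut and a directed Eulerian subgraph (either possibly empty); this is an equivalence relation on $\mathcal O(G)$. For $\rho\in\mathcal O(G)$ and nonnegative integers $p,q$, $\bar\kappa_\rho(G;p,q)$ is the number of pairs $(f,g)$ with $f$ an integer tension and $g$ an integer flow of $(G,\rho)$ with $0\le f\le p$, $0\le g\le q$ edgewise, and $\bar\kappa(G;p,q)=\sum_\rho\bar\kappa_\rho(G;p,q)$ over a set of distinct representatives $\rho$ of the cut-Eulerian classes (a polynomial in $p,q$, independent of the representatives). *)

(* Defs.v *)
From HB Require Import structures.
From mathcomp Require Export all_boot all_order all_algebra.
From mathcomp Require Export boolp.

Set Implicit Arguments.
Unset Strict Implicit.
Unset Printing Implicit Defensive.

Import GRing.Theory.
Local Open Scope ring_scope.

(* Finite multigraphs, loops and parallel edges allowed. The ends of an edge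
   are listed in an arbitrary order; this order only serves as the reference
   direction with respect to which orientations are encoded. *)
Record multigraph := Multigraph {
  vertex : finType;
  edge : finType;
  ends : edge -> vertex * vertex
}.

Section Multigraph.
Variable G : multigraph.
Local Notation V := (vertex G).
Local Notation E := (edge G).
Implicit Types (X B C D : {set E}) (S : {set V}) (e : E) (v : V).

Definition adj X : rel V := fun u v =>
  [exists e in X, (ends e == (u, v)) || (ends e == (v, u))].

Definition ncomp X : nat := n_comp (adj X) [set: V].

Definition rank X : nat := (#|V| - ncomp X)%N.
Definition nullity X : nat := (#|X| - rank X)%N.

Definition rank_poly : {poly {poly rat}} :=
  \sum_(X : {set E}) 'X ^+ (rank [set: E] - rank X) * 'Y ^+ nullity X.

(* [rho e = false] is the reference direction of [e], [rho e = true] the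
   reversed one; in particular a loop has two distinct orientations. *)
Definition orientation := {ffun E -> bool}.
Implicit Types rho sigma : orientation.

Definition tail rho e : V := if rho e then (ends e).2 else (ends e).1.
Definition head rho e : V := if rho e then (ends e).1 else (ends e).2.

Definition differ rho sigma : {set E} := [set e | rho e != sigma e].

Definition cut S : {set E} :=
  [set e | ((ends e).1 \in S) (+) ((ends e).2 \in S)].
Definition is_cut X : bool := [exists S, X == cut S].
Definition bond B : bool := minset (fun X => (X != set0) && is_cut X) B.

Definition directed_bond rho B : bool :=
  bond B && [exists S, (B == cut S) &&
    [forall e in B, forall e' in B,
      (tail rho e \in S) == (tail rho e' \in S)]].

(* As [partition] only has nonempty blocks, the empty cut is included. *)
Definition locally_directed_cut rho C : bool :=
  is_cut C && [exists P : {set {set E}},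
    partition P C && [forall B in P, directed_bond rho B]].

Definition directed_eulerian rho D : bool :=
  [forall v, #|[set e in D | head rho e == v]|
             == #|[set e in D | tail rho e == v]|].

Definition cut_eulerian_equiv : rel orientation := fun rho sigma =>
  [exists C, exists D,
    [&& C :|: D == differ rho sigma, [disjoint C & D],
        locally_directed_cut rho C & directed_eulerian rho D]].

Definition ce_representatives (T : {set orientation}) : Prop :=
  forall rho, exists! sigma, sigma \in T /\ cut_eulerian_equiv rho sigma.

Definition tension rho (f : E -> int) : Prop :=
  exists h : V -> int, forall e, f e = h (tail rho e) - h (head rho e).

Definition flow rho (g : E -> int) : Prop :=
  forall v, \sum_(e | head rho e == v) g e = \sum_(e | tail rho e == v) g e.

(* An integer function f on the edges with 0 <= f <= p is encoded as a finite
   function with values in 'I_p.+1 = {0, ..., p}. *)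
Definition int_of_bounded (n : nat) (f : {ffun E -> 'I_n.+1}) : E -> int :=
  fun e => (val (f e))%:Z.

Definition tension_flow (p q : nat) rho
    (fg : {ffun E -> 'I_p.+1} * {ffun E -> 'I_q.+1}) : Prop :=
  tension rho (int_of_bounded fg.1) /\ flow rho (int_of_bounded fg.2).

Definition kappa rho (p q : nat) : nat :=
  #|[set fg : {ffun E -> 'I_p.+1} * {ffun E -> 'I_q.+1}
      | `[< tension_flow rho fg >]]|.

Definition kappa_bar (T : {set orientation}) (p q : nat) : nat :=
  \sum_(rho in T) kappa rho p q.

Definition tension_flow_triples (T : {set orientation}) (p q : nat) :=
  [set t : orientation * ({ffun E -> 'I_p.+1} * {ffun E -> 'I_q.+1})
    | (t.1 \in T) && `[< tension_flow t.1 t.2 >]].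

End Multigraph.

(* Main.v *)
(* Record an orientation rho as x_rho in {0,1}^E, and let T and F be the
   orthogonal lattices of integer tensions and flows in the reference direction.
   If a vector v with entries in {-1,0,1} is t + phi with t in T and phi in F,
   then t.phi = 0 with all terms t_e phi_e <= 0, so that t and phi have disjoint
   supports; hence rho and sigma are cut-Eulerian equivalent iff x_rho and x_sigma
   lie in the same coset of T + F. By Minty's lemma every coset contains some x_rho.

   For p, q > 0 a triple (rho, f, g), read in the reference direction, is sent to
   the residues of f mod p and g mod q and to the set X recording
   x_rho - f/p - g/q where both residues vanish. Conversely, given residues and X,
   choose lifts f0, g0 and w close to f0/p + g0/q; any x_rho = w + t + phi with t in
   T and phi in F yields y = f0 + p t and z = g0 + q phi with all y_e z_e <= 0, and
   y.z = 0 forces 0 <= f <= p and 0 <= g <= q. This counts the triples as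
   sum_X p^(r(E)-r(X)) q^n(X).

   For q = 0 the same argument reduces to the equality between the number of score
   vectors of the orientations of a graph and its number of forests, proved by
   deletion-contraction. The case p = 0 follows from p > 0, because (p+1)^c(G) times
   the number of tensions with values in [0,p] is a polynomial in p >= 0. *)

Require Import Defs.
From mathcomp Require Import zify ring.

Import GRing.Theory.
Import Num.Theory Order.TTheory.
Local Open Scope ring_scope.

Set Implicit Arguments.
Unset Strict Implicit.
Unset Printing Implicit Defensive.

(** * Circulations and potentials *)

Section Chains.
Variable G : multigraph.
Local Notation V := (vertex G).
Local Notation E := (edge G).

Definition src (e : E) : V := (ends e).1.
Definition dst (e : E) : V := (ends e).2.

Definition bdry (A : zmodType) (c : E -> A) (v : V) : A :=
  \sum_(e | src e == v) c e - \sum_(e | dst e == v) c e.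

Definition cobdry (A : zmodType) (h : V -> A) (e : E) : A := h (src e) - h (dst e).

Definition circulation (A : zmodType) (c : E -> A) : Prop := bdry c =1 (fun=> 0).

Definition potential (A : zmodType) (f : E -> A) : Prop :=
  exists h : V -> A, f =1 cobdry h.

(** Summation by parts: [cobdry] is the transpose of [bdry]. The potential stays integral so that
    [c] may take values in any abelian group, in particular modulo [q]. *)
Lemma green (A : zmodType) (c : E -> A) (h : V -> int) :
  \sum_v bdry c v *~ h v = \sum_e c e *~ cobdry h e.
Proof.
have E1 (k : E -> V) :
    \sum_e c e *~ h (k e) = \sum_v (\sum_(e | k e == v) c e) *~ h v.
  rewrite (partition_big k predT) //=; apply: eq_bigr => v _.
  by rewrite mulrz_suml; apply: eq_bigr => e /eqP->.
under eq_bigr do rewrite mulrzBl.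
rewrite sumrB -!E1 -sumrB; apply: eq_bigr => e _.
by rewrite -mulrzBr.
Qed.

Lemma eq_bdry (A : zmodType) (c d : E -> A) : c =1 d -> bdry c =1 bdry d.
Proof. by move=> cd v; congr (_ - _); apply: eq_bigr. Qed.

Lemma bdryD (A : zmodType) (c d : E -> A) v :
  bdry (fun e => c e + d e) v = bdry c v + bdry d v.
Proof. by rewrite /bdry !big_split /= opprD addrACA. Qed.

Lemma bdryN (A : zmodType) (c : E -> A) v : bdry (fun e => - c e) v = - bdry c v.
Proof. by rewrite /bdry !sumrN opprD. Qed.

Lemma bdryM (a : int) (c : E -> int) v : bdry (fun e => a * c e) v = a * bdry c v.
Proof. by rewrite /bdry -!mulr_sumr mulrBr. Qed.

Lemma bdry0 (A : zmodType) v : bdry (fun=> 0 : A) v = 0.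
Proof. by rewrite /bdry !big1 // subr0. Qed.

Lemma bdry_delta (e0 : E) v :
  bdry (fun e => (e == e0)%:Z) v = (src e0 == v)%:Z - (dst e0 == v)%:Z.
Proof.
have E1 (k : E -> V) : \sum_(e | k e == v) (e == e0)%:Z = (k e0 == v)%:Z.
  rewrite (eq_bigr (fun e => if e == e0 then 1 else 0)); last by move=> e _; case: eqP.
  by rewrite -big_mkcondr big_mkcond (bigD1 e0) //= eqxx andbT big1 ?addr0 // => [|e
    /negPf->];
    [case: eqP | rewrite andbF].
by rewrite /bdry !E1.
Qed.

Lemma circulation_orthogonal (c : E -> int) (f : E -> int) :
  circulation c -> potential f -> \sum_e c e * f e = 0.
Proof.
move=> cc [h fh]; transitivity (\sum_e c e *~ cobdry h e).
  by apply: eq_bigr => e _; rewrite fh mulrzz.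
by rewrite -green big1 // => v _; rewrite cc mul0rz.
Qed.

Lemma circulationB (A : zmodType) (c d : E -> A) :
  circulation c -> circulation d -> circulation (fun e => c e - d e).
Proof. by move=> cc cd v; rewrite bdryD bdryN cc cd subr0. Qed.

Lemma circulationD (A : zmodType) (c d : E -> A) :
  circulation c -> circulation d -> circulation (fun e => c e + d e).
Proof. by move=> cc cd v; rewrite bdryD cc cd addr0. Qed.

Lemma eq_circulation (A : zmodType) (c d : E -> A) :
  c =1 d -> circulation c -> circulation d.
Proof. by move=> cd cc v; rewrite -(eq_bdry cd). Qed.

Lemma eq_potential (A : zmodType) (c d : E -> A) : c =1 d -> potential c -> potential d.
Proof. by move=> cd [h ch]; exists h => e; rewrite -cd. Qed.

Lemma potentialD (A : zmodType) (c d : E -> A) :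
  potential c -> potential d -> potential (fun e => c e + d e).
Proof.
move=> [h ch] [k dk]; exists (fun v => h v + k v) => e.
by rewrite ch dk /cobdry opprD addrACA.
Qed.

Lemma potentialB (A : zmodType) (c d : E -> A) :
  potential c -> potential d -> potential (fun e => c e - d e).
Proof.
move=> [h ch] [k dk]; exists (fun v => h v - k v) => e.
by rewrite ch dk /cobdry opprD !opprK addrACA opprB (addrC (k _)).
Qed.

(** The values of [h] at the two ends of an edge are congruent modulo [p], so rounding $h/p$ down
    divides each difference exactly. *)
Lemma potential_div (p : int) (t : E -> int) :
  p != 0 -> potential (fun e => p * t e) -> potential t.
Proof.
move=> p0 [h th]; exists (fun v => (h v %/ p)%Z) => e.
have hE : h (src e) = t e * p + h (dst e) by rewrite mulrC th /cobdry subrK.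
by rewrite /cobdry hE divzMDl // addrK.
Qed.

Lemma circulation_div (p : int) (t : E -> int) :
  p != 0 -> circulation (fun e => p * t e) -> circulation t.
Proof.
move=> p0 ct v; apply: (mulfI p0).
by rewrite mulr0 -(ct v) bdryM.
Qed.

(** Edges of [fw] may be traversed forwards, those of [bw] backwards. Either [v] is reachable from
    [u] and a simple path gives a unit flow, or the set of vertices reachable from [u] is closed
    under all permitted moves. *)
Lemma alternating_path (fw bw : pred E) (u v : V) :
  (exists c : E -> int,
     (forall w, bdry c w = (w == u)%:Z - (w == v)%:Z) /\
     (forall e, [\/ c e = 0, c e = 1 /\ fw e | c e = -1 /\ bw e])) \/
  (exists R : {set V}, [/\ u \in R, v \notin R,
     forall e, fw e -> src e \in R -> dst e \in R &
     forall e, bw e -> dst e \in R -> src e \in R]).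
Proof.
pose step a b := [exists e, fw e && (ends e == (a, b)) || bw e && (ends e == (b, a))].
have [/connectP[p0 step_p0 ->]|nuv] := boolP (connect step u v); last first.
  right; exists [set w | connect step u w]; rewrite !inE connect0; split=> // e fe;
    rewrite !inE => /connect_trans; apply; apply/connect1/existsP; exists e.
    by rewrite fe -surjective_pairing eqxx.
  by rewrite fe -surjective_pairing eqxx orbT.
left; case/shortenP: step_p0 => p step_p uniq_p _ {p0}.
(* The support clause drives the induction: [u] does not recur on the path, so its first edge is not
   yet used and the coefficients stay in {-1, 0, 1}. *)
have [c [bc cc _]] : exists c : E -> int,
   [/\ (forall w, bdry c w = (w == u)%:Z - (w == last u p)%:Z),
     (forall e, [\/ c e = 0, c e = 1 /\ fw e | c e = -1 /\ bw e]) &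
     (forall e, c e != 0 -> (src e \in u :: p) && (dst e \in u :: p))];
  last by exists c.
elim: p u step_p uniq_p => [|a p IH] u /=.
  by move=> _ _; exists (fun=> 0); split=> [w|e|e] /=;
    [rewrite bdry0 subrr|constructor 1|by []].
move=> /andP[/existsP[e0 e0P] step_p] /andP[u_p uniq_p].
have [c [bc cc sc]] := IH a step_p uniq_p.
have ce0 : c e0 = 0.
  apply/eqP/negPn/negP => /sc /andP[s d]; case/negP: u_p.
  by case/orP: e0P => /andP[_ /eqP ends_e0]; move: s d; rewrite /src /dst ends_e0.
pose s : int := if fw e0 && (ends e0 == (u, a)) then 1 else -1.
have sP : (s = 1 /\ fw e0 /\ ends e0 = (u, a)) \/ (s = -1 /\ bw e0 /\ ends e0 = (a, u)).
  rewrite /s; move: e0P; case: (fw e0 && _) / andP => [[? /eqP ?] _|_ /= /andP[? /eqP ?]].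
    by left.
  by right.
exists (fun e => c e + s * (e == e0)%:Z); split=> [w|e|e].
- rewrite bdryD bc bdryM bdry_delta.
  case: sP => [[-> [_ ends_e0]]|[-> [_ ends_e0]]]; rewrite /src /dst ends_e0 /=
    !(eq_sym w); ring.
- have [->|ne] := eqVneq e e0; last by rewrite mulr0 addr0; apply: cc.
  rewrite ce0 add0r mulr1; case: sP => [[-> [? _]]|[-> [? _]]].
    by constructor 2.
  by constructor 3.
- have [->|ne] := eqVneq e e0.
    move=> _; case: sP => [[_ [_ ends_e0]]|[_ [_ ends_e0]]];
      by rewrite /src /dst ends_e0 /= !inE !eqxx ?orbT.
  by rewrite mulr0 addr0 => /sc /andP[s1 s2]; rewrite !(in_cons u) s1 s2 !orbT.
Qed.
End Chains.

(** * Points of the cube in the cosets of T + F *)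

Section Cosets.
Variable G : multigraph.
Local Notation V := (vertex G).
Local Notation E := (edge G).

Definition crossing (R : {set V}) : E -> int := cobdry (fun v => (v \in R)%:Z).

Lemma potential_crossing R : potential (crossing R).
Proof. by exists (fun v => (v \in R)%:Z). Qed.

Lemma crossingE R e : crossing R e = (src e \in R)%:Z - (dst e \in R)%:Z.
Proof. by []. Qed.

Lemma circulation_close (c : E -> int) (e0 : E) (a : int) :
    (forall w, bdry c w = a * ((w == src e0)%:Z - (w == dst e0)%:Z)) ->
  circulation (fun e => c e - a * (e == e0)%:Z).
Proof.
move=> bc w; rewrite bdryD bdryN bdryM bdry_delta bc !(eq_sym w); exact: subrr.
Qed.

(* Minty's painting lemma: if x is not a 0/1 vector at e0, moving along a
   directed cycle or cut through e0 brings x closer to the centre of the cube. *)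
Lemma centering_step (x : E -> int) (e0 : E) : ~~ (0 <= x e0 <= 1) ->
  exists t phi : E -> int, [/\ potential t, circulation phi,
    `|2 * (x e0 + t e0 + phi e0) - 1| < `|2 * x e0 - 1| &
    forall e, `|2 * (x e + t e + phi e) - 1| <= `|2 * x e - 1|].
Proof.
move=> xe0.
pose s : int := if 1 < x e0 then 1 else -1.
have sP : (s = 1 /\ 1 < x e0) \/ (s = -1 /\ x e0 < 0).
  by rewrite /s; case: ifP => h; [left | right; split=> //; move: xe0 h; lia].
pose u := if 1 < x e0 then src e0 else dst e0.
pose v := if 1 < x e0 then dst e0 else src e0.
(* Edges with [x e <= 0] may be raised and those with [1 <= x e] lowered by 1 without moving away
   from 1/2. A path of such moves closed up by [e0], or else the cut around the vertices reached,
   moves [x e0] in the direction of [- s]. *)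
have [[c [bc cP]]|[R [uR vR fwR bwR]]] := alternating_path [pred e | x e <= 0] [pred e
  | 1 <= x e] u v.
  exists (fun=> 0), (fun e => c e - s * (e == e0)%:Z); split.
  - by exists (fun=> 0) => e; rewrite /cobdry subrr.
  - by apply: circulation_close => w; rewrite bc /s /u /v; case: ifP => _; ring.
  - rewrite eqxx; case: (cP e0) => /= [|[]|[]]; case: sP => [[-> ]|[-> ]]; lia.
  move=> e; have [->|_] := eqVneq e e0;
    case: (cP e) => /= [|[]|[]]; case: sP => [[-> ]|[-> ]]; try lia.
  1-6: by case: (cP e0) => /= [|[]|[]]; lia.
exists (fun e => - crossing R e), (fun=> 0); split.
- have [h hE] := potential_crossing R; exists (fun w => - h w) => e.
  by rewrite hE /cobdry opprD.
- by move=> w; rewrite bdry0.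
- rewrite crossingE; move: uR vR xe0 {sP}; rewrite /u /v;
  case: ifP => xe0' -> /negPf->; lia.
move=> e; move: (fwR e) (bwR e); rewrite crossingE /=.
by case: (src e \in R); case: (dst e \in R); case: (lerP (x e) 0) => xe f b; lia.
Qed.

(** Each centering step lowers $\sum_e |2w_e-1|$, a natural number measuring the distance to the
    centre of the cube, so the steps end inside the cube. *)
Lemma cube_in_coset (w : E -> int) : exists t phi : E -> int,
  [/\ potential t, circulation phi & forall e, 0 <= w e + t e + phi e <= 1].
Proof.
have [n le_n] : exists n, (\sum_e absz (2 * w e - 1)%R <= n)%N by exists (\sum_e absz
  (2 * w e - 1)%R)%N.
elim/ltn_ind: n w le_n => n IH w le_n.
have [/forallP w01|/forallPn[e0 we0]] := boolP [forall e, 0 <= w e <= 1].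
  exists (fun=> 0), (fun=> 0); split=> [|v|e]; last by rewrite !addr0.
    by exists (fun=> 0) => e; rewrite /cobdry subrr.
  by rewrite bdry0.
have [t [phi [pt cphi lt0 le]]] := centering_step we0.
pose w' e := w e + t e + phi e.
have lt_w' : (\sum_e absz (2 * w' e - 1)%R < n)%N.
  apply: leq_trans le_n; rewrite (bigD1 e0) //= [leqRHS](bigD1 e0) //= -addSn.
  apply: leq_add; first by rewrite -ltz_nat !abszE; exact: lt0.
  by apply: leq_sum => e _; rewrite -lez_nat !abszE; exact: le.
have [t' [phi' [pt' cphi' w'01]]] := IH _ lt_w' w' (leqnn _).
exists (fun e => t e + t' e), (fun e => phi e + phi' e); split.
- exact: potentialD.
- exact: circulationD.
by move=> e; move: (w'01 e); rewrite /w'; lia.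
Qed.

Lemma sum_nonpos_eq0 (F : E -> int) :
  (forall e, F e <= 0) -> \sum_e F e = 0 -> forall e, F e = 0.
Proof.
move=> F0 sF e; apply/eqP; rewrite -oppr_eq0; apply/eqP.
have : \sum_e (- F e) = 0 by rewrite sumrN sF oppr0.
by move/psumr_eq0P; apply=> // i _; rewrite oppr_ge0.
Qed.

(* Since v.t = t.t, each nonpositive term t_e (v_e - t_e) vanishes. *)
Lemma unit_vector_split (v t phi : E -> int) :
    (forall e, -1 <= v e <= 1) -> potential t -> circulation phi ->
    (forall e, v e = t e + phi e) ->
  forall e, (t e = v e /\ phi e = 0) \/ (t e = 0 /\ phi e = v e).
Proof.
move=> v1 pt cphi vE e.
have t0 : t e * phi e = 0.
  apply: (sum_nonpos_eq0 (F := fun e => t e * phi e)) => [e'|].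
    by move: (v1 e') (vE e'); nia.
  by under eq_bigr do rewrite mulrC; apply: circulation_orthogonal.
by move/eqP: t0; rewrite mulf_eq0 vE => /orP[]/eqP->; rewrite ?add0r ?addr0; [right|left].
Qed.

End Cosets.

(** * Cut-Eulerian equivalence *)

Section CutEulerian.
Variable G : multigraph.
Local Notation V := (vertex G).
Local Notation E := (edge G).
Implicit Types (rho sigma : orientation G) (B C D : {set E}) (S : {set V}).

Definition sgo rho e : int := if rho e then -1 else 1.
(** The cube vector $x_\rho$. The value 1 marks the reference direction, which [rho] itself encodes
    by [false]. *)
Definition fwd rho e : int := (~~ rho e)%:Z.

Lemma sgoK rho e (a : int) : sgo rho e * (sgo rho e * a) = a.
Proof. by rewrite /sgo; case: ifP; rewrite ?mul1r // !mulN1r opprK. Qed.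

Lemma sgo_cobdry (A : zmodType) rho (h : V -> A) e :
  h (tail rho e) - h (head rho e) = cobdry h e *~ sgo rho e.
Proof.
by rewrite /tail /head /sgo /cobdry /src /dst; case: (rho e);
  rewrite ?mulrNz mulr1z ?opprB.
Qed.

Lemma tensionP rho (f : E -> int) : tension rho f <-> potential (fun e => sgo rho e * f
  e).
Proof.
split=> -[h hE]; exists h => e.
  by rewrite hE sgo_cobdry mulrzz [cobdry h e * _]mulrC sgoK.
by rewrite sgo_cobdry -hE mulrzz mulrC sgoK.
Qed.

Lemma flowP rho (g : E -> int) : flow rho g <-> circulation (fun e => sgo rho e * g e).
Proof.
have bE v : bdry (fun e => sgo rho e * g e) v =
    \sum_(e | tail rho e == v) g e - \sum_(e | head rho e == v) g e.
  rewrite /bdry ![\sum_(e | _ == v) _]big_mkcond -!sumrB; apply: eq_bigr => e _.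
  rewrite /sgo /tail /head /src /dst; case: (rho e); rewrite ?mul1r ?mulN1r //.
  by case: (_ == v); case: (_ == v); rewrite ?oppr0 ?opprK ?subrr ?addr0 ?add0r ?sub0r
    ?addNr.
split=> H v; first by rewrite bE H subrr.
by apply/eqP; rewrite eq_sym -subr_eq0 -bE H.
Qed.

Lemma directed_eulerianP rho D :
  directed_eulerian rho D <-> flow rho (fun e => (e \in D)%:Z).
Proof.
have cE (k : E -> V) v : \sum_(e | k e == v) (e \in D)%:Z = #|[set e in D | k e == v]|%:Z.
  rewrite -[RHS]natz -sumr_const big_mkcond [RHS]big_mkcond; apply: eq_bigr => e _.
  by rewrite [e \in [set _ | _]]inE; case: (k e == v); case: (e \in D).
split=> [/forallP H v|H]; first by rewrite !cE (eqP (H v)).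
by apply/forallP => v; move: (H v); rewrite !cE => -[->].
Qed.

Lemma in_cut rho S e : (e \in cut S) = (tail rho e \in S) (+) (head rho e \in S).
Proof. by rewrite inE /tail /head; case: (rho e) => //; rewrite addbC. Qed.

Lemma directed_bond_tension rho B :
  directed_bond rho B -> tension rho (fun e => (e \in B)%:Z).
Proof.
case/andP=> _ /existsP[S /andP[/eqP BS /forall_inP sameS]].
have [[e0 e0B e0S]|nS] : {e | e \in B & tail rho e \in S} + {forall e, e \in B -> tail
  rho e \notin S}.
  case: (pickP [pred e | (e \in B) && (tail rho e \in S)]) => [e /andP[]|nS].
    by left; exists e.
  by right=> e eB; move: (nS e); rewrite /= eB => /negbT.
  exists (fun v => (v \in S)%:Z) => e; move: (in_cut rho S e); rewrite -BS.
  case: (boolP (e \in B)) => [eB|_]; last by do 2!case: (_ \in S).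
  by move/forall_inP: (sameS e0 e0B) => /(_ e eB); rewrite e0S => /eqP <-;
    case: (_ \in S).
exists (fun v => - (v \in S)%:Z) => e; move: (in_cut rho S e); rewrite -BS.
case: (boolP (e \in B)) => [eB|_]; last by do 2!case: (_ \in S).
by rewrite (negPf (nS e eB)); case: (_ \in S).
Qed.

Lemma locally_directed_cut_tension rho C :
  locally_directed_cut rho C -> tension rho (fun e => (e \in C)%:Z).
Proof.
case/andP=> _ /existsP[P /andP[partP /forall_inP dirP]].
have /choice[h hE] (B : {set E}) : exists h : V -> int,
    B \in P -> forall e, (e \in B)%:Z = h (tail rho e) - h (head rho e).
  have [BP|_] := boolP (B \in P); last by exists (fun=> 0).
  by have [h hE] := directed_bond_tension (dirP B BP); exists h.
exists (fun v => \sum_(B in P) h B v) => e.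
rewrite -sumrB; transitivity (\sum_(B in P) (e \in B)%:Z);
  last by apply: eq_bigr => B /hE->.
case/and3P: partP => /eqP covP trivP _.
rewrite -covP; have [eC|eC] := boolP (e \in cover P); last first.
  rewrite big1 // => B BP; case: (boolP (e \in B)) => // eB.
  by case/negP: eC; apply/bigcupP; exists B.
rewrite (bigD1 (pblock P e)) /= ?pblock_mem // mem_pblock eC big1 ?addr0 // => B
  /andP[BP ne].
by case: (boolP (e \in B)) => // eB; rewrite (def_pblock trivP BP eB) eqxx in ne.
Qed.

(** A directed cut without minimality among all cuts. Bonds are produced from it: a dicut that is
    minimal among dicuts is already minimal among cuts. *)
Definition dicut rho B := (B != set0) && [exists S, (B == cut S) && [forall e in B,
  tail rho e \in S]].

Lemma dicut_tension rho B : dicut rho B -> tension rho (fun e => (e \in B)%:Z).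
Proof.
case/andP=> _ /existsP[S /andP[/eqP BS /forall_inP tS]].
exists (fun v => (v \in S)%:Z) => e; move: (in_cut rho S e) (tS e); rewrite -BS.
by case: (e \in B) => [+ /(_ isT)|+ _]; do 2!case: (_ \in S).
Qed.

(* An edge of a cut B' inside the dicut B of S crosses S forwards, so that the
   cuts of S :&: S' and S :|: ~: S' are again dicuts inside B. *)
Lemma min_dicut_bond rho B : minset (dicut rho) B -> directed_bond rho B.
Proof.
case/minsetP=> /andP[B0 /existsP[S /andP[/eqP BS /forall_inP tS]]] minB.
apply/andP; split; last first.
  apply/existsP; exists S; rewrite BS eqxx /=; rewrite -BS.
  by apply/forall_inP => e eB; apply/forall_inP => e' e'B; rewrite !tS.
apply/minsetP; split; first by rewrite B0; apply/existsP; exists S; rewrite BS.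
move=> B' /andP[B'0 /existsP[S' /eqP B'S']] sB'B.
have headB e : e \in B -> head rho e \notin S.
  by move=> eB; move: (tS e eB); have := in_cut rho S e; rewrite -BS eB;
    do 2!case: (_ \in S).
have in_B e : ((tail rho e \in S) (+) (head rho e \in S)) = (e \in B) by rewrite BS
  (in_cut rho).
have in_B' e : ((tail rho e \in S') (+) (head rho e \in S')) = (e \in B') by rewrite
  B'S' (in_cut rho).
have same e : e \notin B -> (tail rho e \in S) = (head rho e \in S) /\ (tail rho e \in
  S') = (head rho e \in S').
  move=> eB; have eB' : e \notin B' by apply: contra eB; apply: (subsetP sB'B).
  by move: (in_B e) (in_B' e); rewrite (negPf eB) (negPf eB'); do 4!case: (_ \in _).
have sub S1 : (forall e, e \notin B -> (tail rho e \in S1) = (head rho e \in S1)) ->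
    (forall e, e \in B -> tail rho e \notin S1 -> head rho e \notin S1) ->
    (exists e, e \in cut S1) -> cut S1 = B.
  move=> sameS1 dirS1 [e1 e1S1].
  have subB : cut S1 \subset B.
    by apply/subsetP => e; apply: contraLR => /sameS1; rewrite (in_cut rho) => ->;
      rewrite addbb.
  apply: minB => //; apply/andP; split; first by apply/set0Pn; exists e1.
  apply/existsP; exists S1; rewrite eqxx; apply/forall_inP => e eS1.
  apply/negPn/negP => tn; move: eS1 (dirS1 e (subsetP subB e eS1) tn).
  by rewrite (in_cut rho) (negPf tn) /= => ->.
have [e1 e1B'] := set0Pn _ B'0.
have e1B := subsetP sB'B _ e1B'.
apply/eqP; rewrite eqEsubset sB'B /=; apply/subsetP => e2 e2B; apply/negPn/negP => e2B'.
have S1B : (exists e, e \in cut (S :&: S')) -> cut (S :&: S') = B.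
  apply: sub => e eB; rewrite !inE; first by have [-> ->] := same e eB.
  by rewrite (tS e eB) (negPf (headB e eB)).
have S2B : (exists e, e \in cut (S :|: ~: S')) -> cut (S :|: ~: S') = B.
  apply: sub => e eB; rewrite !inE; first by have [-> ->] := same e eB.
  by rewrite (tS e eB).
have in1 e : e \in B -> (e \in cut (S :&: S')) = (tail rho e \in S').
  by move=> eB; rewrite (in_cut rho) !inE (tS e eB) (negPf (headB e eB)) addbF.
have in2 e : e \in B -> (e \in cut (S :|: ~: S')) = (head rho e \in S').
  by move=> eB; rewrite (in_cut rho) !inE (tS e eB) (negPf (headB e eB)) /= negbK.
(* Membership in [S'] is thus the same for all tails of [B], and the same for all heads, so the
   edges of [B] lie all inside [B'] or all outside, against [e1] and [e2]. *)
have all1 e e' : e \in B -> e' \in B -> tail rho e \in S' -> tail rho e' \in S'.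
  by move=> eB e'B; rewrite -!in1 // => H; rewrite S1B //; exists e.
have all2 e e' : e \in B -> e' \in B -> head rho e \in S' -> head rho e' \in S'.
  by move=> eB e'B; rewrite -!in2 // => H; rewrite S2B //; exists e.
move: (in_B' e1) (in_B' e2); rewrite e1B' (negPf e2B').
move: (all1 e1 e2 e1B e2B) (all1 e2 e1 e2B e1B) (all2 e1 e2 e1B e2B) (all2 e2 e1 e2B e1B).
by do 4!case: (_ \in S') => // ;
  (try by move=> _ _ _ /(_ isT)); (try by move=> _ _ /(_ isT));
    (try by move=> _ /(_ isT)); (try by move=> /(_ isT)).
Qed.

(** The potential drops by 1 along the edges of [C] and is constant along the others, so no edge
    enters a superlevel set and only edges of [C] leave it. *)
Lemma tension_dicut rho C : C != set0 -> tension rho (fun e => (e \in C)%:Z) ->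
  exists2 B, dicut rho B & B \subset C.
Proof.
case/set0Pn=> e0 e0C [h hE].
pose S := [set v | h (tail rho e0) <= h v].
exists (cut S).
  apply/andP; split.
    apply/set0Pn; exists e0; rewrite (in_cut rho) !inE lexx.
    by move: (hE e0); rewrite e0C; lia.
  apply/existsP; exists S; rewrite eqxx; apply/forall_inP => e.
  by rewrite (in_cut rho) !inE; move: (hE e); case: (e \in C); lia.
by apply/subsetP => e; rewrite (in_cut rho) !inE; move: (hE e); case: (e \in C) => //;
  lia.
Qed.

(** Directed bonds are peeled off one at a time: a minimal dicut inside [C] is one, and subtracting
    its tension leaves the 0/1 tension of a smaller set. *)
Lemma tension_locally_directed_cut rho C :
  tension rho (fun e => (e \in C)%:Z) -> locally_directed_cut rho C.
Proof.
move=> tC; apply/andP; split.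
  (* The edges of [C] are exactly those along which the parity of the potential changes. *)
  case: tC => h hE; apply/existsP; exists [set v | (h v %% 2)%Z == 1].
  apply/eqP/setP => e; rewrite (in_cut rho) !inE; move: (hE e); case: (e \in C); lia.
have [n le_n] := ubnP #|C|; elim: n C le_n tC => // n IH C le_n tC.
have [->|C0] := eqVneq C set0.
  apply/existsP; exists set0; rewrite partition_set0 eqxx /=.
  by apply/forall_inP => B; rewrite inE.
have [B0 dB0 sB0C] := tension_dicut C0 tC.
have [B minB sBB0] := minset_exists dB0.
have sBC := subset_trans sBB0 sB0C.
have dB := minsetp minB; have /andP[B_0 _] := dB.
have [||P' /andP[partP' /forall_inP dirP']] := existsP (IH (C :\: B) _ _).
- have [e eB] := set0Pn _ B_0; rewrite -ltnS (leq_trans _ le_n) // ltnS.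
  apply/proper_card/properP; split; first exact: subsetDl.
  by exists e; [apply: (subsetP sBC) | rewrite inE eB].
- have [h hE] := tC; have [k kE] := dicut_tension dB.
  exists (fun v => h v - k v) => e.
  transitivity ((e \in C)%:Z - (e \in B)%:Z); last by rewrite hE kE; ring.
  rewrite inE.
  by case: (boolP (e \in B)) => [/(subsetP sBC)->|_] //=; rewrite subr0.
apply/existsP; exists (B |: P'); apply/andP; split.
  have -> : C = B :|: (C :\: B) by rewrite setDE setUIr setUCr setIT; apply/esym/setUidPr.
  by apply: partitionU1 => //; rewrite disjoints_subset setDE setCI setCK subsetUr.
apply/forall_inP => A /setU1P[->|/dirP' //]; exact: min_dicut_bond.
Qed.

Lemma fwdB rho sigma e : fwd rho e - fwd sigma e = sgo rho e * (e \in differ rho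
  sigma)%:Z.
Proof. by rewrite /fwd /sgo inE; case: (rho e); case: (sigma e). Qed.

(** From here on the equivalence is seen only as equality of cosets of T + F. Conversely,
    [unit_vector_split] makes the supports of [t] and [phi] disjoint, and these supports are the cut
    and the Eulerian part. *)
Lemma cut_eulerian_equivP rho sigma :
  cut_eulerian_equiv rho sigma <->
  exists t phi : E -> int, [/\ potential t, circulation phi &
    forall e, fwd rho e - fwd sigma e = t e + phi e].
Proof.
split.
  case/existsP=> C /existsP[D /and4P[/eqP CD disCD
    /locally_directed_cut_tension/tensionP tC]].
  move=> /directed_eulerianP/flowP fD; do 2!eexists; split; [exact: tC | exact: fD |].
  move=> e; rewrite fwdB -CD -mulrDr inE; congr (_ * _).
  by case: (boolP (e \in C)) => [/(disjointFr disCD)->|].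
case=> t [phi [pt cphi vE]].
have v1 e : -1 <= fwd rho e - fwd sigma e <= 1.
  by rewrite /fwd; case: (rho e); case: (sigma e).
have split_v := unit_vector_split v1 pt cphi vE.
pose C := [set e | t e != 0]; pose D := [set e | phi e != 0].
have v0 e : (e \in differ rho sigma) = (fwd rho e - fwd sigma e != 0).
  by rewrite fwdB /sgo; case: (rho e); case: (_ \in _).
have tE e : t e = sgo rho e * (e \in C)%:Z.
  rewrite inE; have [[-> _]|[-> _]] := split_v e; last by rewrite mulr0.
  by rewrite -v0 fwdB.
have phiE e : phi e = sgo rho e * (e \in D)%:Z.
  rewrite inE; have [[_ ->]|[_ ->]] := split_v e; first by rewrite mulr0.
  by rewrite -v0 fwdB.
apply/existsP; exists C; apply/existsP; exists D; apply/and4P; split.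
- apply/eqP/setP => e; rewrite v0 !inE.
  by have [[-> ->]|[-> ->]] := split_v e; rewrite eqxx ?orbF.
- rewrite -setI_eq0; apply/eqP/setP => e; rewrite !inE.
  by have [[_ ->]|[-> _]] := split_v e; rewrite eqxx ?andbF.
- by apply/tension_locally_directed_cut/tensionP; apply: eq_potential pt.
- by apply/directed_eulerianP/flowP; apply: eq_circulation cphi.
Qed.

(** Every coset contains a cube vector, and the orientation it encodes may be exchanged for its
    representative without leaving the coset. *)
Lemma representative_in_coset (T : {set orientation G}) (w : E -> int) :
    ce_representatives T ->
  exists rho t phi, [/\ rho \in T, potential t, circulation phi &
    forall e, fwd rho e = w e + t e + phi e].
Proof.
move=> hT; have [t [phi [pt cphi cube]]] := cube_in_coset w.
pose rho : orientation G := [ffun e => w e + t e + phi e != 1].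
have [sigma [[sigmaT /cut_eulerian_equivP[t' [phi' [pt' cphi' vE]]]] _]] := hT rho.
exists sigma, (fun e => t e - t' e), (fun e => phi e - phi' e).
split=> // [||e]; [exact: potentialB | exact: circulationB |].
have -> : fwd sigma e = fwd rho e - (t' e + phi' e) by rewrite -vE; ring.
have -> : fwd rho e = w e + t e + phi e by rewrite /fwd ffunE; move: (cube e); lia.
by ring.
Qed.

(** The counterpart of [representative_in_coset]: a coset contains only one representative. The two
    components then vanish separately because tensions and flows meet only in 0. *)
Lemma representative_inj (T : {set orientation G}) rho sigma (t phi : E -> int) :
    ce_representatives T -> rho \in T -> sigma \in T -> potential t -> circulation phi ->
    (forall e, fwd rho e - fwd sigma e = t e + phi e) ->
  [/\ rho = sigma, forall e, t e = 0 & forall e, phi e = 0].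
Proof.
move=> hT rhoT sigmaT pt cphi vE.
have rs : rho = sigma.
  have [r [_ uniq_r]] := hT rho.
  rewrite -(uniq_r rho); first rewrite -(uniq_r sigma) //.
    by split=> //; apply/cut_eulerian_equivP; exists t, phi.
  split=> //; apply/cut_eulerian_equivP; exists (fun=> 0), (fun=> 0).
  split=> [|v|e]; [|exact: bdry0|by rewrite subrr].
  by exists (fun=> 0) => e; rewrite /cobdry subrr.
have v0 : forall e, -1 <= fwd rho e - fwd sigma e <= 1 by move=> e; rewrite rs subrr.
split=> // e; have := unit_vector_split v0 pt cphi vE e; rewrite rs subrr; by case=> -[].
Qed.

End CutEulerian.

(** * Group-valued flows and tensions *)

Section Counting.
Variable G : multigraph.
Local Notation V := (vertex G).
Local Notation E := (edge G).
Implicit Types (X Y : {set E}).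

Lemma edge_set_ind (P : {set E} -> Prop) :
  P set0 -> (forall e Y, e \notin Y -> P Y -> P (e |: Y)) -> forall X, P X.
Proof.
move=> P0 PU X; have [n] := ubnP #|X|; elim: n X => // n IH X.
have [->//|[e eX]] := set_0Vmem X.
rewrite -(setD1K eX) cardsU1 !inE eqxx => leX.
by apply: PU; [rewrite !inE eqxx | apply: IH].
Qed.

(** [alternating_path] with the edges of [Y] other than [e0] usable both ways: either they connect
    the ends of [e0], closing a cycle, or they leave these ends in different components. *)
Lemma cycle_or_cut Y e0 :
  (exists gamma : E -> int, [/\ circulation gamma, gamma e0 = 1 &
     forall e, e \notin e0 |: Y -> gamma e = 0]) \/
  (exists R : {set V}, [/\ dst e0 \in R, src e0 \notin R &
     forall e, e \in Y -> e != e0 -> (src e \in R) = (dst e \in R)]).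
Proof.
pose Y' := Y :\ e0.
have [[c [bc cP]]|[R [dR sR fwR bwR]]] := alternating_path [pred e in Y'] [pred e in
  Y'] (dst e0) (src e0).
  have cN e : e \notin Y' -> c e = 0.
    by move=> eY; case: (cP e) => [//|[_ /=]|[_ /=]]; rewrite (negPf eY).
  left; exists (fun e => c e - (-1) * (e == e0)%:Z); split.
  - by apply: circulation_close => w; rewrite bc; ring.
  - by rewrite cN ?eqxx // !inE eqxx.
  by move=> e; rewrite !inE negb_or => /andP[/negPf ne eY];
    rewrite cN ?ne // !inE (negPf eY) andbF.
right; exists R; split=> // e eY ne.
have eY' : e \in Y' by rewrite !inE ne.
by apply/idP/idP; [apply: fwR | apply: bwR].
Qed.

Definition constant_on (A : finType) X : {set {ffun V -> A}} :=
  [set h : {ffun V -> A} | [forall e in X, h (src e) == h (dst e)]].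

Lemma adj_sym X : symmetric (adj X).
Proof. by move=> u v; apply: eq_existsb => e; rewrite orbC. Qed.

(** Such a labelling is determined by its values at the roots of the components. With two labels
    this turns comparisons of [ncomp] into comparisons of sets of two-colourings, the method used
    below. *)
Lemma card_constant_on (A : finType) X : #|constant_on A X| = (#|A| ^ ncomp X)%N.
Proof.
have symX : connect_sym (adj X) by apply: sym_connect_sym; apply: adj_sym.
have ncompE : ncomp X = #|roots (adj X)|.
  by rewrite /ncomp /n_comp_mem; apply: eq_card => v; rewrite !inE andbT.
(* [pffun_on] needs a default value [a0]. For empty [A] both sides are 1 or 0 according to whether
   [V] is empty. *)
case: (pickP (mem A)) => [a0 _|A0]; last first.
  have A00 : #|A| = 0%N by apply: eq_card0.
  case: (pickP (mem V)) => [v0 _|V0]; last first.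
    have -> : ncomp X = 0%N by rewrite ncompE; apply: eq_card0 => v; have := V0 v.
    rewrite expn0; apply/eqP/cards1P.
    have h0 : {ffun V -> A} by apply: finfun => v; have := V0 v.
    exists h0; apply/setP => h; rewrite !inE; apply/forall_inP/eqP => _.
      by apply/ffunP => v; have := V0 v.
    by move=> e; have := V0 (src e).
  rewrite A00 exp0n; last by rewrite ncompE; apply/card_gt0P;
    exists (fingraph.root (adj X) v0); apply: roots_root.
  by apply: eq_card0 => h; have := A0 (h v0).
pose lift_root (k : {ffun V -> A}) := [ffun v => k (fingraph.root (adj X) v)].
rewrite ncompE -(card_pffun_on a0 (roots (adj X)) (mem A)).
rewrite -[RHS](card_in_imset (f := lift_root)); last first.
  move=> k1 k2 in1 in2 /ffunP k12; apply/ffunP => v.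
  have /pffun_onP[s1 _] : k1 \in pffun_on a0 (roots (adj X)) (mem A) by exact: in1.
  have /pffun_onP[s2 _] : k2 \in pffun_on a0 (roots (adj X)) (mem A) by exact: in2.
  have [rv|nrv] := boolP (v \in roots (adj X)).
    by have := k12 v; rewrite !ffunE (eqP rv).
  have k0 (k : {ffun V -> A}) : {subset a0.-support k <= roots (adj X)} -> k v = a0.
    by move=> sk; apply/eqP; apply: contraNT nrv => kv; apply: sk.
  by rewrite !k0 //; apply/subsetP.
apply: eq_card => h; rewrite inE; apply/forall_inP/imsetP => [hX|[k _ ->] e eX].
  have h_conn u v : connect (adj X) u v -> h u = h v.
    case/connectP=> p pth ->; elim: p u pth => //= w p IH u /andP[/exists_inP[e eX
      ends_e] /IH<-].
    by have /eqP := hX e eX; rewrite /src /dst; case/orP: ends_e => /eqP->.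
  exists [ffun v => if v \in roots (adj X) then h v else a0].
    apply/pffun_onP; split=> [|a _] //.
    by apply/subsetP => v; rewrite inE ffunE; case: ifP; rewrite ?eqxx.
  by apply/ffunP => v; rewrite !ffunE (_ : _ \in _);
    [apply/h_conn/connect_root | apply: roots_root].
rewrite !ffunE; suff -> : fingraph.root (adj X) (src e) = fingraph.root (adj X) (dst e)
  by [].
apply/eqP; rewrite root_connect //; apply/connect1/exists_inP; exists e => //.
by rewrite -surjective_pairing eqxx.
Qed.

Lemma ncomp_le X : (ncomp X <= #|V|)%N.
Proof. exact: max_card. Qed.

(** If a two-colouring is constant along [Y], pairing its coboundary with [gamma] leaves only the
    term of [e0], so it is constant along [e0] too. *)
Lemma ncomp_cycle Y e0 (gamma : E -> int) :
    circulation gamma -> gamma e0 = 1 -> (forall e, e \notin e0 |: Y -> gamma e = 0) ->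
  ncomp (e0 |: Y) = ncomp Y.
Proof.
move=> cg g1 gY; apply/eqP; rewrite -(eqn_exp2l _ _ (ltnSn 1)) -card_bool
  -!card_constant_on.
apply/eqP/eq_card => h; rewrite !inE; apply/forall_inP/forall_inP => hY e eY.
  by apply: hY; rewrite inE eY orbT.
have [-> {e eY}|ne] := eqVneq e e0; last first.
  by apply: hY; move: eY; rewrite !inE (negPf ne).
have := circulation_orthogonal cg (ex_intro _ (fun v => (h v)%:Z) (fun=> erefl)).
rewrite (bigD1 e0) //= big1 => [|e ne].
  by rewrite g1 addr0 mul1r /cobdry; case: (h (src _)); case: (h (dst _)).
have [eY|eY] := boolP (e \in Y); last by rewrite gY ?mul0r // !inE negb_or ne.
by rewrite /cobdry (eqP (hY e eY)) subrr mulr0.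
Qed.

(** Among two-colourings constant along [Y], exchanging the colours on [R] swaps those that agree at
    the ends of [e0] with those that do not, so adding [e0] halves their number. *)
Lemma ncomp_cut Y e0 (R : {set V}) :
    e0 \notin Y -> dst e0 \in R -> src e0 \notin R ->
    (forall e, e \in Y -> e != e0 -> (src e \in R) = (dst e \in R)) ->
  ncomp Y = (ncomp (e0 |: Y)).+1.
Proof.
move=> e0Y dR sR YR; apply/eqP; rewrite -(eqn_exp2l _ _ (ltnSn 1)) expnS -card_bool
  -!card_constant_on.
pose flip (h : {ffun V -> bool}) := [ffun v => h v (+) (v \in R)].
have flipK : involutive flip.
  by move=> h; apply/ffunP => v; rewrite !ffunE -addbA addbb addbF.
rewrite -(cardsID (constant_on _ (e0 |: Y))).
have -> : constant_on bool Y :&: constant_on bool (e0 |: Y) = constant_on bool (e0 |: Y).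
  apply/setIidPr/subsetP => h; rewrite !inE => /forall_inP hY; apply/forall_inP => e eY.
  by apply: hY; rewrite inE eY orbT.
rewrite card_bool mul2n -addnn eqn_add2l -(card_imset _ (inv_inj flipK)).
apply/eqP/eq_card => h; rewrite -{1}[h]flipK (mem_imset _ _ (inv_inj flipK)).
have memY : (flip h \in constant_on bool Y) = (h \in constant_on bool Y).
  rewrite !inE; apply: eq_forallb => e; case: (boolP (e \in Y)) => //= eY.
  by rewrite !ffunE YR ?(memPn e0Y) //; case: (h _); case: (h _); case: (_ \in _).
have memU k : (k \in constant_on bool (e0 |: Y)) = (k (src e0) == k (dst e0)) && (k \in
  constant_on bool Y).
  rewrite !inE; apply/forall_inP/andP => [kU|[k0 /forall_inP kY] e].
    by split; [apply: kU; rewrite !inE eqxx | apply/forall_inP => e eY; apply: kU;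
      rewrite !inE eY orbT].
  by rewrite !inE => /orP[/eqP->|/kY].
rewrite in_setD (memU (flip h)) (memU h) memY !ffunE dR (negPf sR).
by case: (h \in _); case: (h (src e0)); case: (h (dst e0)).
Qed.

Lemma ncomp0 : ncomp (set0 : {set E}) = #|V|.
Proof.
apply/eqP; rewrite -(eqn_exp2l _ _ (ltnSn 1)) -card_bool -card_constant_on -card_ffun.
by apply/eqP/eq_card => h; rewrite !inE; apply/forall_inP => e; rewrite inE.
Qed.

(** The dichotomy behind the inductions on edge sets: a new edge either closes a cycle, with a
    circulation as witness, or is a bridge, with a cut as witness. *)
Lemma rank_add Y e0 : e0 \notin Y ->
  (exists gamma : E -> int, [/\ circulation gamma, gamma e0 = 1,
     (forall e, e \notin e0 |: Y -> gamma e = 0) & rank (e0 |: Y) = rank Y]) \/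
  (exists R : {set V}, [/\ dst e0 \in R, src e0 \notin R,
     (forall e, e \in Y -> (src e \in R) = (dst e \in R)) & rank (e0 |: Y) = (rank
       Y).+1]).
Proof.
move=> e0Y; have [[gamma [cg g1 gY]]|[R [dR sR YR]]] := cycle_or_cut Y e0; [left|right].
  by exists gamma; rewrite /rank (ncomp_cycle cg g1 gY).
exists R; split=> // [e eY|]; first by apply: YR => //; apply: contraNneq e0Y => <-.
by rewrite /rank; have := ncomp_le Y; rewrite (ncomp_cut e0Y dR sR YR) => /subnSK.
Qed.

Lemma rank_le_card X : (rank X <= #|X|)%N.
Proof.
elim/edge_set_ind: X => [|e Y eY IH]; first by rewrite /rank ncomp0 subnn.
rewrite cardsU1 eY; case: (rank_add eY) => [[gamma [_ _ _ ->]]|[R [_ _ _ ->]]] //.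
exact: leqW.
Qed.

Definition circulations (A : finZmodType) X : {set {ffun E -> A}} :=
  [set g : {ffun E -> A} |
     [forall v, bdry g v == 0] && [forall e, (e \notin X) ==> (g e == 0)]].

Lemma circulationsP (A : finZmodType) X (g : {ffun E -> A}) :
  reflect (circulation g /\ forall e, e \notin X -> g e = 0) (g \in circulations A X).
Proof.
rewrite inE; apply: (iffP andP) => -[H1 H2]; split.
- by move=> v; apply/eqP/(forallP H1).
- by move=> e eX; apply/eqP/(implyP (forallP H2 e)).
- by apply/forallP => v; rewrite H1.
by apply/forallP => e; apply/implyP => /H2->.
Qed.

(** [green] for the indicator of [R], which only [e0] crosses within the support of [c]. In
    particular a circulation supported there vanishes on the bridge [e0]. *)
Lemma bdry_cut (A : zmodType) (c : E -> A) (Y : {set E}) e0 (R : {set V}) :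
    dst e0 \in R -> src e0 \notin R ->
    (forall e, e \in Y -> (src e \in R) = (dst e \in R)) ->
    (forall e, e \notin e0 |: Y -> c e = 0) ->
  \sum_(v in R) bdry c v = - c e0.
Proof.
move=> dR sR YR cY; transitivity (\sum_v bdry c v *~ (v \in R)%:Z).
  by rewrite big_mkcond; apply: eq_bigr => v _; case: (v \in R).
rewrite green (bigD1 e0) //= big1 => [|e ne].
  by rewrite /cobdry dR (negPf sR) addr0 sub0r mulrNz.
have [eY|eY] := boolP (e \in Y); first by rewrite /cobdry YR // subrr.
by rewrite cY ?mul0rz // !inE negb_or ne.
Qed.

Lemma circulation_mulrz (A : zmodType) (gamma : E -> int) (a : A) :
  circulation gamma -> circulation (fun e => a *~ gamma e).
Proof.
move=> cg v; rewrite /bdry -!mulrz_sumr -mulrzBr.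
by have := cg v; rewrite /bdry => ->.
Qed.

(** A bridge carries no circulation. An edge closing a cycle [gamma] contributes a factor [#|A|],
    since each circulation is uniquely one on [Y] plus a multiple of [gamma], the multiplier being
    its value at [e0]. *)
Lemma card_circulations (A : finZmodType) X : #|circulations A X| = (#|A| ^ nullity X)%N.
Proof.
elim/edge_set_ind: X => [|e0 Y e0Y IH].
  have -> : nullity (set0 : {set E}) = 0%N by rewrite /nullity cards0.
  rewrite expn0; apply/eqP/cards1P; exists [ffun=> 0]; apply/setP => g; rewrite inE.
  apply/circulationsP/eqP => [[_ g0]|->].
    by apply/ffunP => e; rewrite g0 ?inE // ffunE.
  split=> [v|e]; last by rewrite ffunE.
  by rewrite (eq_bdry (d := fun=> 0)) ?bdry0 // => e; rewrite ffunE.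
have [[gamma [cg g1 gY rE]]|[R [dR sR YR rE]]] := rank_add e0Y; last first.
  have -> : nullity (e0 |: Y) = nullity Y by rewrite /nullity rE cardsU1 e0Y subSS.
  rewrite -IH; apply: eq_card => g; apply/circulationsP/circulationsP => -[cg gY];
    split=> // e eY.
    have [->|ne] := eqVneq e e0; last by rewrite gY // !inE negb_or ne.
    apply/eqP; rewrite -oppr_eq0 -(bdry_cut dR sR YR gY) big1 // => v _; exact: cg.
  by apply: gY; apply: contra eY; rewrite inE orbC => ->.
have -> : nullity (e0 |: Y) = (nullity Y).+1.
  by rewrite /nullity rE cardsU1 e0Y subSn // rank_le_card.
rewrite expnSr -IH -cardsT -cardsX.
pose add_cycle (ga : {ffun E -> A} * A) : {ffun E -> A} := [ffun e => ga.1 e + ga.2 *~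
  gamma e].
have g0 g : g \in circulations A Y -> g e0 = 0.
  by case/circulationsP=> _; apply.
rewrite -[RHS](card_in_imset (f := add_cycle)); last first.
  move=> [g a] [g' a'] /setXP[/g0 /= ge0 _] /setXP[/g0 /= ge0' _] /ffunP eq_ga.
  have eq_a : a = a' by have := eq_ga e0; rewrite !ffunE /= ge0 ge0' g1 !add0r !mulr1z.
  congr pair => //; apply/ffunP => e; have := eq_ga e; rewrite !ffunE /= eq_a;
    exact: addIr.
apply: eq_card => g; apply/circulationsP/imsetP => [[cirg gX]|[[g' a]
  /setXP[/circulationsP /= [cg' gY'] _] ->]].
  exists ([ffun e => g e - g e0 *~ gamma e], g e0).
    apply/setXP; split; last by rewrite inE.
    apply/circulationsP; split.
      apply: (eq_circulation (c := fun e => g e - g e0 *~ gamma e)) => [e|];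
        first by rewrite ffunE.
      by apply: circulationB => //; apply: circulation_mulrz.
    move=> e eY; rewrite ffunE; have [->|ne] := eqVneq e e0;
      first by rewrite g1 mulr1z subrr.
    by rewrite gX ?gY ?mulr0z ?subrr // !inE negb_or ne.
  by apply/ffunP => e; rewrite !ffunE subrK.
split=> [|e eX]; last first.
  by rewrite ffunE gY // mulr0z addr0 gY' //; apply: contra eX; rewrite inE orbC => ->.
apply: (eq_circulation (c := fun e => g' e + a *~ gamma e)) => [e|];
  first by rewrite ffunE.
by apply: circulationD => //; apply: circulation_mulrz.
Qed.

Definition cobdryf (A : finZmodType) (h : {ffun V -> A}) : {ffun E -> A} :=
  [ffun e => cobdry h e].

(** The fibres of the coboundary map are cosets of its kernel, the labellings constant on the
    components of the graph. *)
Lemma card_cobdryf_preim (A : finZmodType) (Q : {set {ffun E -> A}}) :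
    {subset Q <= [set cobdryf h | h : {ffun V -> A}]} ->
  #|[set h | cobdryf h \in Q]| = (#|Q| * #|A| ^ ncomp [set: E])%N.
Proof.
move=> Qim; rewrite -sum1_card (partition_big (@cobdryf A) (mem Q)) /=;
  last by move=> h; rewrite inE.
rewrite -sum_nat_const; apply: eq_bigr => f fQ.
have /imsetP[h0 _ fE] := Qim f fQ.
rewrite -card_constant_on sum1_card.
have addI (h : {ffun V -> A}) : injective (fun k : {ffun V -> A} => [ffun v => h v + k
  v]).
  by move=> k k' /ffunP kk; apply/ffunP => v; have := kk v; rewrite !ffunE => /addrI.
rewrite -[RHS](card_imset _ (addI h0)); apply: eq_card => h; rewrite -[LHS]topredE /=.
apply/andP/imsetP => [[_ /eqP hf]|[k]].
  exists [ffun v => h v - h0 v]; last by apply/ffunP => v; rewrite !ffunE addrC subrK.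
  rewrite inE; apply/forall_inP => e _; rewrite !ffunE.
  have /ffunP/(_ e) : cobdryf h = cobdryf h0 by rewrite hf fE.
  rewrite !ffunE /cobdry => hh; apply/eqP.
  have -> : h (src e) = h0 (src e) - h0 (dst e) + h (dst e) by rewrite -hh subrK.
  by rewrite addrAC [h0 _ - _]addrC addrK addrC.
rewrite inE => /forall_inP kE ->.
suff hE : cobdryf [ffun v => h0 v + k v] = f by rewrite inE hE fQ eqxx.
by apply/ffunP => e; rewrite fE !ffunE /cobdry !ffunE (eqP (kE e _)) ?inE // opprD
  addrACA subrr addr0.
Qed.

Definition potentials (A : finZmodType) X : {set {ffun E -> A}} :=
  [set cobdryf h | h in constant_on A X].

Lemma potentialsP (A : finZmodType) X (f : {ffun E -> A}) :
  reflect (potential f /\ forall e, e \in X -> f e = 0) (f \in potentials A X).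
Proof.
apply: (iffP imsetP) => [[h]|[[h hE] fX]].
  rewrite inE => /forall_inP hX ->; split=> [|e eX].
    by exists h => e; rewrite ffunE.
  by rewrite ffunE /cobdry (eqP (hX e eX)) subrr.
exists [ffun v => h v]; last by apply/ffunP => e; rewrite ffunE hE /cobdry !ffunE.
rewrite inE; apply/forall_inP => e eX; rewrite !ffunE -subr_eq0.
by have := fX e eX; rewrite hE /cobdry => ->.
Qed.

Lemma card_potentials (A : finZmodType) X :
  #|potentials A X| = (#|A| ^ (rank [set: E] - rank X))%N.
Proof.
have A0 : (0 < #|A|)%N by apply/card_gt0P; exists 0.
have leX : (ncomp [set: E] <= ncomp X)%N.
  rewrite -(leq_exp2l _ _ (ltnSn 1)) -card_bool -!card_constant_on;
    apply/subset_leq_card/subsetP => h.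
  by rewrite !inE => /forall_inP hE; apply/forall_inP => e _; apply: hE.
have -> : (rank [set: E] - rank X = ncomp X - ncomp [set: E])%N.
  by rewrite /rank; have := ncomp_le X; lia.
have Qim : {subset potentials A X <= [set cobdryf h | h : {ffun V -> A}]}.
  by move=> f /imsetP[h _ ->]; apply: imset_f.
apply/eqP; rewrite -(eqn_pmul2r (m := #|A| ^ ncomp [set: E])) ?expn_gt0 ?A0 //.
rewrite -expnD subnK // -card_cobdryf_preim // -card_constant_on; apply/eqP/eq_card => h.
rewrite [LHS]inE; apply/idP/idP => [/potentialsP[_ hX]|hX]; last exact: imset_f.
rewrite inE; apply/forall_inP => e eX; rewrite -subr_eq0.
by have := hX e eX; rewrite ffunE /cobdry => ->.
Qed.

End Counting.

(** * Positive p and q *)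

Section Residues.
Variable n : nat.

(** Reduction modulo [n.+1], written as a multiple of 1 so that its compatibility with [bdry] and
    [cobdry] comes from that of [*~]. For [n = 0] the target is the trivial group. *)
Definition residue (z : int) : 'I_n.+1 := inZp 1 *~ z.

Lemma residue_nat (m : nat) : residue m%:Z = inZp m.
Proof.
apply/val_inj; rewrite /residue -pmulrn Zp_mulrn /=.
by rewrite modnMml mul1n.
Qed.

Lemma residue_ord (a : 'I_n.+1) : residue (val a)%:Z = a.
Proof. by rewrite residue_nat valZpK. Qed.

Lemma residue_eq0 (z : int) : (residue z == 0) = (n.+1%:Z %| z)%Z.
Proof.
have -> : residue z = residue (z %% n.+1%:Z)%Z.
  rewrite {1}(divz_eq z n.+1%:Z) /residue mulrzDr mulrC mulrzA.
  have -> : (inZp 1 : 'I_n.+1) *~ n.+1%:Z = 0.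
    by rewrite -/(residue _) residue_nat; apply/val_inj; rewrite /= modnn.
  by rewrite mul0rz add0r.
rewrite (sameP dvdz_mod0P eqP); case: (z %% _)%Z (modz_ge0 z (isT : n.+1%:Z != 0))
  (ltz_pmod z (isT : 0 < n.+1%:Z)) => // m _ lt_m.
by rewrite residue_nat -val_eqE /= modn_small.
Qed.

Lemma residue_eq (a b : int) : (residue a == residue b) = (n.+1%:Z %| a - b)%Z.
Proof. by rewrite -subr_eq0 -residue_eq0 /residue mulrzBr. Qed.

End Residues.

Lemma small_dvdz_eq0 (d s : int) : 0 <= s < d -> (d %| s)%Z -> s = 0.
Proof.
by move=> sd /dvdz_mod0P; rewrite modz_small.
Qed.

Lemma cube_range0 (r x : int) : 0 < r -> 0 <= x <= 1 -> r * (x - 1) <= 0 <= r * x.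
Proof. by move=> r0 /andP[x0 x1]; rewrite pmulr_rle0 // pmulr_rge0 // x0 subr_le0 x1. Qed.

Lemma range_nondvd (r x y : int) : 0 < r -> r * (x - 1) <= y <= r * x -> ~~ (r %| y)%Z ->
  r * (x - 1) < y < r * x.
Proof.
move=> r0 /andP[l u] nd; rewrite !lt_neqAle l u !andbT; apply/andP; split.
  by apply: contraNneq nd => <-; apply: dvdz_mulr.
by apply: contraNneq nd => ->; apply: dvdz_mulr.
Qed.

(** When [r] does not divide [y], the bounds force [x] to be the ceiling of $y/r$. *)
Lemma nondvd_diff (r x1 x2 y1 y2 t : int) : 0 < r ->
    r * (x1 - 1) <= y1 <= r * x1 -> r * (x2 - 1) <= y2 <= r * x2 ->
    y1 - y2 = r * t -> ~~ (r %| y1)%Z -> x1 - x2 = t.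
Proof.
move=> r0 b1 b2 e nd1.
have nd2 : ~~ (r %| y2)%Z.
  apply: contra nd1 => d2; have -> : y1 = r * t + y2 by rewrite -e subrK.
  by apply: rpredD => //; apply: dvdz_mulr.
have := range_nondvd r0 b1 nd1; have := range_nondvd r0 b2 nd2; nia.
Qed.

(** * Arithmetic on a single edge *)

Section EdgeArithmetic.
Variables p q : int.
Hypotheses (p0 : 0 < p) (q0 : 0 < q).

(** The trace of a triple on one edge, read in the reference direction: [x] is the coordinate of
    $x_\rho$, and [y], [z] are the signed values of tension and flow. Their product vanishes by
    orthogonality. *)
Definition conformal (x y z : int) : Prop :=
  [/\ 0 <= x <= 1, p * (x - 1) <= y <= p * x, q * (x - 1) <= z <= q * x & y * z = 0].

(* x - y/p - z/q = 1, cleared of denominators. *)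
Definition marked (x y z : int) : bool := p * q * x - q * y - p * z == p * q.

Lemma marked_mul x a b : marked x (p * a) (q * b) = (x - a - b == 1).
Proof.
rewrite /marked -[RHS](inj_eq (mulfI (lt0r_neq0 (mulr_gt0 p0 q0)))) mulr1.
by congr (_ == _); ring.
Qed.

Lemma marked_dvd x y z : conformal x y z -> marked x y z -> (p %| y)%Z && (q %| z)%Z.
Proof.
case=> _ _ _ /eqP; rewrite mulf_eq0 => /orP[]/eqP->;
  rewrite /marked mulr0 subr0 => /eqP H; rewrite dvdz0 ?andbT /=.
  apply/dvdzP; exists (x - 1); apply: (mulfI (lt0r_neq0 p0)).
  by move: H; lia.
apply/dvdzP; exists (x - 1); apply: (mulfI (lt0r_neq0 q0)).
by move: H; lia.
Qed.

Lemma conformal_mul x a b : conformal x (p * a) (q * b) ->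
  [/\ x - 1 <= a <= x, x - 1 <= b <= x & a * b = 0].
Proof.
by case=> _; rewrite !ler_pM2l // => -> -> /eqP;
  rewrite !mulf_eq0 (gt_eqF p0) (gt_eqF q0) /= -mulf_eq0 => /eqP.
Qed.

(** Injectivity on one edge. If one residue is nonzero, the other value vanishes on both sides and
    [nondvd_diff] applies. If both residues vanish, $x-y/p-z/q$ is 0 or 1, and the marks say
    which. *)
Lemma conformal_diff x1 y1 z1 x2 y2 z2 t phi :
    conformal x1 y1 z1 -> conformal x2 y2 z2 ->
    y1 - y2 = p * t -> z1 - z2 = q * phi ->
    ~~ (q %| z1)%Z || marked x1 y1 z1 = ~~ (q %| z2)%Z || marked x2 y2 z2 ->
  x1 - x2 = t + phi.
Proof.
move=> c1 c2 ey ez em.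
have [x01 by1 bz1 yz1] := c1; have [x02 by2 bz2 yz2] := c2.
have [dy|ndy] := boolP (p %| y1)%Z; last first.
  have ndy2 : ~~ (p %| y2)%Z.
    apply: contra ndy => d2; have -> : y1 = p * t + y2 by rewrite -ey subrK.
    by apply: rpredD => //; apply: dvdz_mulr.
  have z10 : z1 = 0 by apply/eqP; move/eqP: yz1; rewrite mulf_eq0 => /orP[/eqP y0|//];
    rewrite y0 dvdz0 in ndy.
  have z20 : z2 = 0 by apply/eqP; move/eqP: yz2; rewrite mulf_eq0 => /orP[/eqP y0|//];
    rewrite y0 dvdz0 in ndy2.
  have -> : phi = 0 by apply: (mulfI (lt0r_neq0 q0)); rewrite -ez z10 z20 subr0 mulr0.
  by rewrite addr0; apply: nondvd_diff by1 by2 ey ndy.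
have [dz|ndz] := boolP (q %| z1)%Z; last first.
  have ndz2 : ~~ (q %| z2)%Z.
    apply: contra ndz => d2; have -> : z1 = q * phi + z2 by rewrite -ez subrK.
    by apply: rpredD => //; apply: dvdz_mulr.
  have y10 : y1 = 0 by apply/eqP; move/eqP: yz1; rewrite mulf_eq0 => /orP[//|/eqP y0];
    rewrite y0 dvdz0 in ndz.
  have y20 : y2 = 0 by apply/eqP; move/eqP: yz2; rewrite mulf_eq0 => /orP[//|/eqP y0];
    rewrite y0 dvdz0 in ndz2.
  have -> : t = 0 by apply: (mulfI (lt0r_neq0 p0)); rewrite -ey y10 y20 subr0 mulr0.
  by rewrite add0r; apply: nondvd_diff bz1 bz2 ez ndz.
have [a1 y1E] : exists a, y1 = p * a by case/dvdzP: dy => a ->; exists a; rewrite mulrC.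
have [b1 z1E] : exists b, z1 = q * b by case/dvdzP: dz => a ->; exists a; rewrite mulrC.
have y2E : y2 = p * (a1 - t) by rewrite mulrBr -y1E -ey; ring.
have z2E : z2 = q * (b1 - phi) by rewrite mulrBr -z1E -ez; ring.
move: em; rewrite y1E z1E y2E z2E !marked_mul !dvdz_mulr // /=.
move: (c1) (c2); rewrite y1E z1E y2E z2E => /conformal_mul[? ? ?] /conformal_mul[? ? ?].
by case: eqP; case: eqP => //; nia.
Qed.

(* The shapes of y and z on an edge of X, where p | f0 and g0 = s mod q, and in the
   next lemma on an edge off X, where f0 = - r mod p and g0 = 0. *)
Lemma marked_edge (k s x : int) : 0 <= s < q -> 0 <= x <= 1 ->
    let y := p * k in let z := q * (x - 1 - k) + s in
  y * z <= 0 /\ (y * z = 0 -> conformal x y z /\ ((q %| z)%Z -> marked x y z)).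
Proof.
move=> hs hx y z; have /andP[s0 sq] := hs; have /andP[x0 x1] := hx.
have yz : y * z <= 0.
  rewrite /y /z -mulrA pmulr_rle0 //.
  case: (ltrgtP k 0) => [k0|k0|->]; last by rewrite mul0r.
    by rewrite nmulr_rle0 // addr_ge0 // pmulr_rge0 //; lia.
  rewrite pmulr_rle0 //; have : q * (x - 1 - k) <= q * (-1) by rewrite ler_pM2l //; lia.
  lia.
split=> // yz0; have /orP[k0|/eqP z0] : (k == 0) || (z == 0).
- by move/eqP: yz0; rewrite mulf_eq0 /y mulf_eq0 (gt_eqF p0).
- rewrite /y /z (eqP k0) subr0 mulr0; split=> [|dz].
    by split; [|exact: cube_range0| lia | rewrite mul0r].
  have s00 : s = 0.
    by apply: (small_dvdz_eq0 hs); move: dz; rewrite rpredDl // dvdz_mulr.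
  by apply/eqP; rewrite s00; ring.
have s00 : s = 0.
  apply: (small_dvdz_eq0 hs); rewrite -(rpredDl (x := q * (x - 1 - k))) ?dvdz_mulr //.
  by rewrite -/z z0 dvdz0.
have kE : k = x - 1.
  by apply/eqP; move/eqP: z0; rewrite /z s00 addr0 mulf_eq0 (gt_eqF q0) subr_eq0 eq_sym.

rewrite /y /z s00 kE subrr mulr0 addr0; split=> [|_]; last by apply/eqP; ring.
by split; [|lia|exact: cube_range0|rewrite mulr0].
Qed.

Lemma unmarked_edge (b r x : int) : 0 <= r < p -> 0 <= x <= 1 ->
    let y := p * (x - b) - r in let z := q * b in
  y * z <= 0 /\ (y * z = 0 -> conformal x y z /\ ~~ marked x y z).
Proof.
move=> hr hx y z; have /andP[r0 rp] := hr; have /andP[x0 x1] := hx.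
have yz : y * z <= 0.
  rewrite /y /z mulrCA pmulr_rle0 //.
  case: (ltrgtP b 0) => [b0|b0|->]; last by rewrite mulr0.
    by rewrite nmulr_lle0 //; have : p * 1 <= p * (x - b); [rewrite ler_pM2l //;
      lia | lia].
  by rewrite pmulr_lle0 // subr_le0; apply: le_trans r0; rewrite pmulr_rle0 //; lia.
have unmarked : (p %| y)%Z -> ~~ marked x y z.
  rewrite /y rpredDl ?dvdz_mulr // rpredN => /(small_dvdz_eq0 hr) r00.
  by rewrite r00 subr0 marked_mul; lia.
split=> // yz0; have /orP[/eqP b0|/eqP y00] : (b == 0) || (y == 0).
- by move/eqP: yz0; rewrite mulf_eq0 /z mulf_eq0 (gt_eqF q0) orbC.
- have c : conformal x y z.
    by rewrite /y /z b0 subr0 mulr0; split; [|lia|exact: cube_range0|rewrite mulr0].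
  by split=> //; apply/negP => m; case/andP: (marked_dvd c m) => /unmarked; rewrite m.
have r00 : r = 0.
  apply: (small_dvdz_eq0 hr); rewrite -rpredN -(rpredDl (x := p * (x - b))) ?dvdz_mulr //.
  by rewrite -/y y00 dvdz0.
have bE : b = x.
  by apply/eqP; move/eqP: y00; rewrite /y r00 subr0 mulf_eq0 (gt_eqF p0) subr_eq0 eq_sym.

split; last by apply: unmarked; rewrite y00 dvdz0.
by rewrite y00 /z bE; split; [|exact: cube_range0|lia|rewrite mul0r].
Qed.

End EdgeArithmetic.

(** * Lifting residues to tensions and flows of representatives *)

Section Lifts.
Variable G : multigraph.
Local Notation V := (vertex G).
Local Notation E := (edge G).
Implicit Types (X Y : {set E}) (rho : orientation G).

(** Circulations modulo [q] lift to integral ones on the same support. If [e0] closes a cycle, a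
    multiple of that cycle carries the value [k e0]; if [e0] is a bridge, [q] divides [k e0], which
    may be replaced by 0. *)
Lemma circulation_lift (q : int) X (k : E -> int) :
    (forall e, e \notin X -> k e = 0) -> (forall v, (q %| bdry k v)%Z) ->
  exists g : E -> int, [/\ circulation g, forall e, e \notin X -> g e = 0 &
    forall e, (q %| g e - k e)%Z].
Proof.
elim/edge_set_ind: X k => [|e0 Y e0Y IH] k kX kq.
  exists (fun=> 0); split=> [v|//|e]; first by rewrite bdry0.
  by rewrite kX ?inE // subrr dvdz0.
have [[gamma [cg g1 gY _]]|[R [dR sR YR _]]] := rank_add e0Y.
  have [|v|g [cirg gX gk]] := IH (fun e => k e - k e0 * gamma e).
  - move=> e eY; have [->|ne] := eqVneq e e0; first by rewrite g1 mulr1 subrr.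
    by rewrite kX ?gY ?mulr0 ?subrr // !inE negb_or ne.
  - by rewrite bdryD bdryN bdryM cg mulr0 subr0.
  exists (fun e => g e + k e0 * gamma e); split=> [|e eX|e].
  - by apply: circulationD => // v; rewrite bdryM cg mulr0.
  - by rewrite gX ?gY ?mulr0 ?addr0 //; apply: contra eX; rewrite inE orbC => ->.
  - by have := gk e; rewrite opprB addrA addrAC.
have ke0 : (q %| k e0)%Z.
  by rewrite -rpredN -(bdry_cut dR sR YR kX) rpred_sum.
have [|v|g [cirg gX gk]] := IH (fun e => k e - k e0 * (e == e0)%:Z).
- move=> e eY; have [->|ne] := eqVneq e e0; first by rewrite mulr1 subrr.
  by rewrite mulr0 subr0 kX // !inE negb_or ne.
- by rewrite bdryD bdryN bdryM; apply: rpredB => //; rewrite dvdz_mulr.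
exists g; split=> // [e eX|e].
  by rewrite gX //; apply: contra eX; rewrite inE orbC => ->.
have := gk e; rewrite opprB addrA addrAC rpredDr // dvdz_mulr //.
Qed.

(** The core of surjectivity: given lifts of the residues and the set [X] are realized by a
    representative. All products [y e * z e] are nonpositive and sum to 0 by orthogonality, so each
    vanishes, and this yields the bounds. *)
Lemma representative_lift (T : {set orientation G}) (p q : int) X (f0 g0 : E -> int) :
    ce_representatives T -> 0 < p -> 0 < q -> potential f0 -> circulation g0 ->
    (forall e, e \in X -> (p %| f0 e)%Z) -> (forall e, e \notin X -> g0 e = 0) ->
  exists rho y z, [/\ rho \in T, potential y, circulation z &
    forall e, [/\ (p %| y e - f0 e)%Z, (q %| z e - g0 e)%Z,
      conformal p q (fwd rho e) (y e) (z e) &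
      (e \in X) = ~~ (q %| z e)%Z || marked p q (fwd rho e) (y e) (z e)]].
Proof.
move=> hT p0 q0 pf0 cg0 f0X g0X.
(* An integral rounding of $f_0/p+g_0/q$. On [X], where [p] divides [f0], the second quotient is
   rounded strictly upwards; off [X], where [g0] is 0, the ceiling of the first is taken. *)
pose w e := if e \in X then (f0 e %/ p)%Z + (g0 e %/ q)%Z + 1 else - (- f0 e %/ p)%Z.
have [rho [t [phi [rhoT pt cphi xE]]]] := representative_in_coset w hT.
pose y e := f0 e + p * t e; pose z e := g0 e + q * phi e.
have py : potential y.
  by apply: potentialD => //; case: pt => h hE; exists (fun v => p * h v) => e;
    rewrite hE /cobdry mulrBr.
have cz : circulation z by apply: circulationD => // v; rewrite bdryM cphi mulr0.
have x01 e : 0 <= fwd rho e <= 1 by rewrite /fwd; case: (rho e).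
have yE1 e : e \in X -> y e = p * ((f0 e %/ p)%Z + t e).
  by move=> eX; rewrite /y mulrDr [p * (_ %/ _)%Z]mulrC divzK ?f0X.
have zE1 e : e \in X -> z e = q * (fwd rho e - 1 - ((f0 e %/ p)%Z + t e)) + (g0 e %% q)%Z.
  move=> eX; rewrite xE /w eX /z {1}(divz_eq (g0 e) q); ring.
have yE2 e : e \notin X -> y e = p * (fwd rho e - phi e) - (- f0 e %% p)%Z.
  move=> eX; rewrite xE /w (negPf eX) /y -{1}(opprK (f0 e)) {1}(divz_eq (- f0 e) p); ring.
have zE2 e : e \notin X -> z e = q * phi e by move=> eX; rewrite /z g0X // add0r.
have modq e : 0 <= (g0 e %% q)%Z < q by rewrite modz_ge0 ?ltz_pmod // lt0r_neq0.
have modp e : 0 <= (- f0 e %% p)%Z < p by rewrite modz_ge0 ?ltz_pmod // lt0r_neq0.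
have yz0 e : y e * z e = 0.
  apply: (sum_nonpos_eq0 (F := fun e => y e * z e)) => [e'|].
    have [eX|eX] := boolP (e' \in X).
      by rewrite yE1 // zE1 //; have [le0 _] := marked_edge p0 q0 ((f0 e' %/ p)%Z + t
        e') (modq e') (x01 e').
    by rewrite yE2 // zE2 //; have [le0 _] := unmarked_edge p0 q0 (phi e') (modp e')
      (x01 e').
  by under eq_bigr do rewrite mulrC; apply: circulation_orthogonal.
have dy e : (p %| y e - f0 e)%Z by rewrite /y addrAC subrr add0r dvdz_mulr.
have dz e : (q %| z e - g0 e)%Z by rewrite /z addrAC subrr add0r dvdz_mulr.
exists rho, y, z; split=> // e; have [eX|eX] := boolP (e \in X).
  have [_ cm] := marked_edge p0 q0 ((f0 e %/ p)%Z + t e) (modq e) (x01 e).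
  have := yz0 e; rewrite yE1 // zE1 // => /cm[c m]; rewrite -zE1 // in c m *;
    rewrite -yE1 // in c m *.
  by split=> //; case: (boolP (q %| z e)%Z) => //= /m ->.
have [_ cm] := unmarked_edge p0 q0 (phi e) (modp e) (x01 e).
have := yz0 e; rewrite yE2 // zE2 // => /cm[c m]; rewrite -zE2 // in c m *;
  rewrite -yE2 // in c m *.
split=> //; by rewrite (negPf m) zE2 // dvdz_mulr.
Qed.

Definition signed n rho (f : {ffun E -> 'I_n}) (e : E) : int := sgo rho e * (f e :
  nat)%:Z.

Lemma tension_flowP p q rho (fg : {ffun E -> 'I_p.+1} * {ffun E -> 'I_q.+1}) :
  tension_flow rho fg <-> potential (signed rho fg.1) /\ circulation (signed rho fg.2).
Proof. by split=> -[/tensionP H1 /flowP H2]; split. Qed.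

Lemma signed_range n rho (f : {ffun E -> 'I_n.+1}) e :
  n%:Z * (fwd rho e - 1) <= signed rho f e <= n%:Z * fwd rho e.
Proof.
by have := ltn_ord (f e); rewrite /signed /fwd /sgo; case: (rho e) => /=; lia.
Qed.

(** The signs of [rho] cancel in the products of tension and flow values, which are therefore
    nonnegative with sum 0. *)
Lemma signed_conformal p q rho (fg : {ffun E -> 'I_p.+1} * {ffun E -> 'I_q.+1}) :
    tension_flow rho fg ->
  forall e, conformal p%:Z q%:Z (fwd rho e) (signed rho fg.1 e) (signed rho fg.2 e).
Proof.
move=> /tension_flowP[pf cg] e; split; try exact: signed_range.
  by rewrite /fwd; case: (rho e).
apply/eqP; rewrite -oppr_eq0; apply/eqP.
apply: (sum_nonpos_eq0 (F := fun e => - (signed rho fg.1 e * signed rho fg.2 e))) =>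
  [e'|].
  by rewrite oppr_le0 /signed mulrACA -expr2 mulr_ge0 // sqr_ge0.
rewrite sumrN; under eq_bigr do rewrite mulrC.
by rewrite (circulation_orthogonal cg pf) oppr0.
Qed.

Definition unsign n rho (y : E -> int) : {ffun E -> 'I_n.+1} :=
  [ffun e => inord (absz (y e))].

Lemma signed_unsign n rho (y : E -> int) :
    (forall e, n%:Z * (fwd rho e - 1) <= y e <= n%:Z * fwd rho e) ->
  forall e, signed rho (unsign n rho y) e = y e.
Proof.
move=> by_ e; have := by_ e; rewrite /signed ffunE /fwd /sgo.
by case: (rho e) => /= ?; rewrite inordK; lia.
Qed.

Lemma signed_inj n rho (f f' : {ffun E -> 'I_n.+1}) :
  (forall e, signed rho f e = signed rho f' e) -> f = f'.
Proof.
move=> ff'; apply/ffunP => e; apply/val_inj => /=.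
by have := ff' e; rewrite /signed /sgo; case: (rho e); lia.
Qed.

End Lifts.

Lemma ltz0S n : (0 : int) < n.+1%:Z. Proof. by []. Qed.

Lemma card_sigma_set (I J : finType) (F : I -> {set J}) :
  #|[set t : I * J | t.2 \in F t.1]| = (\sum_i #|F i|)%N.
Proof.
rewrite -sum1_card; under [RHS]eq_bigr do rewrite -sum1_card.
by rewrite pair_big_dep /=; apply: eq_bigl => t; rewrite inE.
Qed.

(** * The bijection of triples with residues and edge sets *)

Section Modular.
Variable G : multigraph.
Local Notation V := (vertex G).
Local Notation E := (edge G).
Implicit Types (X Y : {set E}) (rho : orientation G).

Lemma card_tension_flow_triples (T : {set orientation G}) p q :
  #|tension_flow_triples T p q| = kappa_bar T p q.
Proof.
rewrite /kappa_bar /kappa.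
transitivity (\sum_rho #|[set fg : {ffun E -> 'I_p.+1} * {ffun E -> 'I_q.+1} | (rho \in
  T) && `[< tension_flow rho fg >]]|)%N.
  by rewrite -card_sigma_set; apply: eq_card => t; rewrite !inE.
rewrite [RHS]big_mkcond; apply: eq_bigr => rho _; case: ifP => // _.
by apply: eq_card0 => fg; rewrite inE.
Qed.

Lemma bdry_mulrz (A : zmodType) (a : A) (c : E -> int) v :
  bdry (fun e => a *~ c e) v = a *~ bdry c v.
Proof. by rewrite /bdry mulrzBr !mulrz_sumr. Qed.

Lemma potential_mulrz (A : zmodType) (a : A) (c : E -> int) :
  potential c -> potential (fun e => a *~ c e).
Proof. by move=> [h hE]; exists (fun v => a *~ h v) => e; rewrite hE /cobdry mulrzBr. Qed.

Lemma potential_lift n (f : {ffun E -> 'I_n.+1}) : potential f ->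
  exists2 f0 : E -> int, potential f0 & forall e, residue n (f0 e) = f e.
Proof.
move=> [h hE]; exists (cobdry (fun v => (h v : nat)%:Z)); first by eexists.
by move=> e; rewrite hE /cobdry /residue mulrzBr -!/(residue _ _) !residue_ord.
Qed.

Lemma circulation_residue_lift n X (g : {ffun E -> 'I_n.+1}) : g \in circulations _ X ->
  exists g0 : E -> int, [/\ circulation g0, forall e, e \notin X -> g0 e = 0 &
    forall e, residue n (g0 e) = g e].
Proof.
move=> /circulationsP[cg gX].
have [e eX|v|g0 [cg0 g0X g0g]] := @circulation_lift G n.+1%:Z X (fun e => (g e : nat)%:Z).
- by rewrite gX.
- rewrite -residue_eq0 /residue -bdry_mulrz; apply/eqP; rewrite -[RHS](cg v).
  by apply: eq_bdry => e; rewrite -/(residue _ _) residue_ord.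
by exists g0; split=> // e; rewrite -[RHS]residue_ord; apply/eqP; rewrite residue_eq.
Qed.

(** The bounds here are [p.+1] and [q.+1], which are also the moduli. Edges where the flow residue
    is nonzero are put into the set, so that this residue is supported on it while the tension
    residue vanishes on it. *)
Definition class_data p q (t : orientation G * ({ffun E -> 'I_p.+2} * {ffun E ->
  'I_q.+2})) :
    {set E} * ({ffun E -> 'I_p.+1} * {ffun E -> 'I_q.+1}) :=
  let y := signed t.1 t.2.1 in let z := signed t.1 t.2.2 in
  ([set e | ~~ (q.+1%:Z %| z e)%Z || marked p.+1%:Z q.+1%:Z (fwd t.1 e) (y e) (z e)],
   ([ffun e => residue p (y e)], [ffun e => residue q (z e)])).

Lemma triplesP (T : {set orientation G}) p q t :
  reflect (t.1 \in T /\ tension_flow t.1 t.2) (t \in tension_flow_triples T p q).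
Proof.
by rewrite inE; apply: (iffP andP) => -[tT /asboolP].
Qed.

Lemma residue_diff n (y1 y2 : E -> int) :
    [ffun e => residue n (y1 e)] = [ffun e => residue n (y2 e)] ->
  exists t, forall e, y1 e - y2 e = n.+1%:Z * t e.
Proof.
move=> /ffunP ry; exists (fun e => (y1 e - y2 e) %/ n.+1%:Z)%Z => e.
by have := ry e; rewrite !ffunE => /eqP; rewrite residue_eq mulrC => /divzK->.
Qed.

(** The common end of the injectivity proofs for [q > 0] and [q = 0]. The last hypothesis covers
    both: flows differing by a multiple of [phi], and flows that are all zero. *)
Lemma tension_flow_eq (T : {set orientation G}) p q t1 t2 (u phi : E -> int) (m n : int) :
    ce_representatives T -> m != 0 -> n != 0 ->
    t1 \in tension_flow_triples T p q -> t2 \in tension_flow_triples T p q ->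
    (forall e, signed t1.1 t1.2.1 e - signed t2.1 t2.2.1 e = m * u e) ->
    (forall e, fwd t1.1 e - fwd t2.1 e = u e + phi e) -> circulation phi ->
    (forall e, phi e = 0 -> signed t1.1 t1.2.2 e - signed t2.1 t2.2.2 e = 0) ->
  t1 = t2.
Proof.
move=> hT m0 n0 /triplesP[T1 /tension_flowP[pf1 cg1]] /triplesP[T2 /tension_flowP[pf2
  cg2]] eu ex cphi ephi.
have pu : potential u.
  by apply: (potential_div m0); apply: eq_potential (potentialB pf1 pf2) => e; rewrite eu.
have [e1 u0 phi0] := representative_inj hT T1 T2 pu cphi ex.
move: eu ephi; rewrite -e1 => eu ephi.
have ef : t1.2.1 = t2.2.1.
  by apply: (signed_inj (rho := t1.1)) => e; apply/eqP; rewrite -subr_eq0 eu u0 mulr0.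
have eg : t1.2.2 = t2.2.2.
  by apply: (signed_inj (rho := t1.1)) => e; apply/eqP; rewrite -subr_eq0 ephi.
by move: t1 t2 e1 ef eg {T1 T2 pf1 pf2 cg1 cg2 ex eu ephi} => [? [? ?]] [? [? ?]] /= ->
  -> ->.
Qed.

Lemma class_data_inj (T : {set orientation G}) p q : ce_representatives T ->
  {in tension_flow_triples T p.+1 q.+1 &, injective (@class_data p q)}.
Proof.
move=> hT t1 t2 in1 in2 [/setP eX /residue_diff[u eu] /residue_diff[phi ephi]].
have [T1 tf1] := triplesP _ _ in1; have [T2 tf2] := triplesP _ _ in2.
have /tension_flowP[pf1 cg1] := tf1; have /tension_flowP[pf2 cg2] := tf2.
apply: (@tension_flow_eq T _ _ t1 t2 u phi p.+1%:Z q.+1%:Z) => // [e||e phi0].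
- have := eX e; rewrite !inE => eXe.
  exact: (conformal_diff (ltz0S p) (ltz0S q) (signed_conformal tf1 e) (signed_conformal
    tf2 e) (eu e) (ephi e) eXe).
- apply: (@circulation_div _ q.+1%:Z) => //.
  by apply: eq_circulation (circulationB cg1 cg2) => e; rewrite ephi.
- by rewrite ephi phi0 mulr0.
Qed.

Lemma class_data_im (T : {set orientation G}) p q : ce_representatives T ->
  [set class_data t | t in tension_flow_triples T p.+1 q.+1] =
  [set u : {set E} * ({ffun E -> 'I_p.+1} * {ffun E -> 'I_q.+1}) |
    u.2 \in setX (potentials _ u.1) (circulations _ u.1)].
Proof.
move=> hT; apply/setP => -[X [f g]]; rewrite [in RHS]inE /= in_setX; apply/imsetP/andP.
  move=> [t /triplesP[tT tf] [-> -> ->]]; have cf := signed_conformal tf.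
  have /tension_flowP[pf cg] := tf; split=> /=.
    apply/potentialsP; split=> [|e].
      by apply: eq_potential (potential_mulrz (inZp 1) pf) => e; rewrite ffunE.
    rewrite inE ffunE => marked_e; apply/eqP; rewrite residue_eq0.
    case/orP: marked_e => [ndz|m]; last first.
      by have /andP[] := marked_dvd (ltz0S p) (ltz0S q) (cf e) m.
    have [_ _ _ /eqP] := cf e; rewrite mulf_eq0 => /orP[/eqP->|/eqP z0];
      first by rewrite dvdz0.
    by rewrite z0 dvdz0 in ndz.
  apply/circulationsP; split=> [|e].
    by apply: eq_circulation (circulation_mulrz (inZp 1) cg) => e; rewrite ffunE.
  by rewrite inE negb_or negbK ffunE => /andP[dz _]; apply/eqP; rewrite residue_eq0.
move=> [/potentialsP[pf fX] cgX].
have [f0 pf0 f0f] := potential_lift pf.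
have [g0 [cg0 g0X g0g]] := circulation_residue_lift cgX.
have [||||e eX||rho [y [z [rhoT py cz yzP]]]] := @representative_lift G T p.+1%:Z
  q.+1%:Z X f0 g0 hT => //.
  by rewrite -residue_eq0 f0f fX.
have yE : forall e, signed rho (unsign p.+1 rho y) e = y e.
  by apply: signed_unsign => e; have [_ _ []] := yzP e.
have zE : forall e, signed rho (unsign q.+1 rho z) e = z e.
  by apply: signed_unsign => e; have [_ _ []] := yzP e.
exists (rho, (unsign p.+1 rho y, unsign q.+1 rho z)).
  apply/triplesP; split=> //=; apply/tension_flowP; split.
    by apply: eq_potential py => e; rewrite yE.
  by apply: eq_circulation cz => e; rewrite zE.
congr (_, (_, _)).
- by apply/setP => e; rewrite inE /= yE zE; have [_ _ _ ->] := yzP e.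
- apply/ffunP => e; rewrite ffunE /= yE -f0f; apply/esym/eqP; rewrite residue_eq.
  by have [] := yzP e.
- apply/ffunP => e; rewrite ffunE /= zE -g0g; apply/esym/eqP; rewrite residue_eq.
  by have [] := yzP e.
Qed.

Theorem kappa_bar_pos (T : {set orientation G}) p q : ce_representatives T ->
  kappa_bar T p.+1 q.+1 =
    (\sum_(X : {set E}) p.+1 ^ (rank [set: E] - rank X) * q.+1 ^ nullity X)%N.
Proof.
move=> hT; rewrite -card_tension_flow_triples -(card_in_imset (class_data_inj hT))
  class_data_im //.
rewrite (card_sigma_set (fun X => setX (potentials _ X) (circulations _ X))).
apply: eq_bigr => X _; by rewrite cardsX card_potentials card_circulations !card_ord.
Qed.

End Modular.

(** * Score vectors and forests *)

(* The vertex dst e0 survives as an isolated vertex, so that the vertex and edge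
   types do not change. *)
Definition contraction (G : multigraph) (e0 : edge G) : multigraph :=
  let merge (v : vertex G) := if v == dst e0 then src e0 else v in
  Multigraph (fun e : edge G => (merge (src e), merge (dst e))).

Section Scores.
Variable G : multigraph.
Local Notation V := (vertex G).
Local Notation E := (edge G).
Implicit Types (X Y U A : {set E}).

(** If [U] is the set of edges keeping the reference direction and the rest are reversed, this is
    the out-degree sequence up to a vector independent of [U]. *)
Definition score U : {ffun V -> int} := [ffun v => bdry (fun e => (e \in U)%:Z) v].

Definition scores A : seq {ffun V -> int} := undup [seq score U | U <- enum (powerset A)].

(** Acyclicity phrased through circulations, a form that is easy to follow under contraction;
    [independentP] identifies it with nullity 0. *)
Definition independent X : Prop := forall phi : E -> int,
  circulation phi -> (forall e, e \notin X -> phi e = 0) -> phi =1 (fun=> 0).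

Definition forests A : {set {set E}} := [set X in powerset A | `[< independent X >]].

Lemma scoresP A (s : {ffun V -> int}) : reflect (exists2 U : {set E}, U \subset A & s =
  score U) (s \in scores A).
Proof.
rewrite mem_undup; apply: (iffP mapP) => -[U].
  by rewrite mem_enum powersetE => UA ->; exists U.
by move=> UA ->; exists U => //; rewrite mem_enum powersetE.
Qed.

Lemma scoreE (c : E -> int) U : (forall e, c e = (e \in U)%:Z) -> forall v, score U v =
  bdry c v.
Proof. by move=> cU v; rewrite ffunE; apply: eq_bdry => e; rewrite cU. Qed.

(** Scores have no gaps in the direction from [v] to [u]: switching the edges of a path inside the
    difference of [U] and [U'] makes one step. Without such a path the net boundary over the
    reachable set would be nonpositive by [green], although it equals [k.+1]. *)
Lemma score_interval A U U' (u v : V) (k : nat) :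
    U \subset A -> U' \subset A ->
    (forall w, score U' w = score U w + k.+1%:Z * ((w == u)%:Z - (w == v)%:Z)) ->
  exists2 U'' : {set E}, U'' \subset A & forall w, score U'' w = score U w + ((w ==
    u)%:Z - (w == v)%:Z).
Proof.
move=> UA U'A sc.
have [[c [bc cP]]|[R [uR vR fwR bwR]]] :=
    alternating_path [pred e in U' :\: U] [pred e in U :\: U'] u v.
  pose U'' := [set e | (e \in U)%:Z + c e == 1].
  have U''E e : (e \in U'')%:Z = (e \in U)%:Z + c e.
    by rewrite [e \in U'']inE; case: (cP e) => [->|[-> /=]|[-> /=]]; rewrite ?inE;
      case: (e \in U); case: (e \in U').
  exists U''.
    apply/subsetP => e; rewrite inE; case: (cP e) => [->|[_ /=]|[-> /=]]; rewrite ?inE.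
    - by case: (boolP (e \in U)) => [/(subsetP UA)|].
    - by case/andP=> _ /(subsetP U'A).
    - by case/andP=> _ ->.
  move=> w; rewrite (scoreE (c := fun e => (e \in U)%:Z + c e)) => [|e];
    last by rewrite U''E.
  by rewrite bdryD bc ffunE.
pose c e : int := (e \in U')%:Z - (e \in U)%:Z.
have bc w : bdry c w = k.+1%:Z * ((w == u)%:Z - (w == v)%:Z).
  have := sc w; rewrite !ffunE => sc'; rewrite bdryD bdryN sc'; ring.
have := green c (fun w => (w \in R)%:Z).
have -> : \sum_w bdry c w *~ (w \in R)%:Z = k.+1%:Z.
  under eq_bigr do rewrite mulrzz bc -mulrA.
  rewrite -mulr_sumr; under eq_bigr do rewrite mulrBl.
  have delta x : \sum_w (w == x)%:Z * (w \in R)%:Z = (x \in R)%:Z.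
    by rewrite (bigD1 x) //= eqxx mul1r big1 ?addr0 // => w /negPf->; rewrite mul0r.
  by rewrite sumrB !delta uR (negPf vR) subr0 mulr1.
move=> kE; have : 0 < \sum_e c e *~ cobdry (fun w => (w \in R)%:Z) e by rewrite -kE.
rewrite ltNge => /negP[]; apply: sumr_le0 => e _; rewrite mulrzz /c /cobdry.
move: (fwR e) (bwR e); rewrite /= !inE.
case: (e \in U); case: (e \in U'); rewrite ?subrr ?mul0r //= => f b.
  by move: (b isT); case: (dst e \in R) => [->|_]; case: (src e \in R).
by move: (f isT); case: (src e \in R) => [->|_]; case: (dst e \in R).
Qed.

End Scores.

(** * Deletion and contraction of an edge that is not a loop *)

Section Contract.
Variable G : multigraph.
Local Notation V := (vertex G).
Local Notation E := (edge G).
Implicit Types (X Y U A : {set E}).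
Variable e0 : E.
Local Notation u := (src e0).
Local Notation v := (dst e0).
Hypothesis uv : u != v.

Lemma bdry_contraction (c : E -> int) (w : V) :
  @bdry (contraction e0) int c w =
    if w == v then 0 else if w == u then bdry c u + bdry c v else bdry c w.
Proof.
pose merge (x : V) := if x == v then u else x.
have sumE (k : E -> V) : \sum_(e | merge (k e) == w) c e =
    \sum_(x | merge x == w) \sum_(e | k e == x) c e.
  rewrite (partition_big k (fun x => merge x == w)) //=.
  apply: eq_bigr => x xw; apply: eq_bigl => e.
  by apply/andP/eqP => [[_ /eqP]|->].
transitivity (\sum_(x | merge x == w) bdry c x).
  by rewrite /bdry sumrB -!sumE.
rewrite /merge; case: (eqVneq w v) => [->|wv].
  by apply: big_pred0 => x; case: ifP => [_|->//]; exact: negPf uv.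
case: (eqVneq w u) => [->|wu].
  rewrite (bigD1 u) /=; last by rewrite (negPf uv) eqxx.
  rewrite (bigD1 v) /=; last by rewrite eqxx eqxx eq_sym uv.
  rewrite big1 ?addr0 // => x; case: ifP => [/eqP->|xv]; first by rewrite eqxx andbF.
  by case: (x == u).
rewrite (big_pred1 w) // => x /=; case: (eqVneq x v) => [->|//].
by rewrite (eq_sym u) (negPf wu) eq_sym (negPf wv).
Qed.

Lemma circulation_contraction (c : E -> int) :
  @circulation (contraction e0) int c <->
  exists k, forall w, bdry c w = k * ((w == u)%:Z - (w == v)%:Z).
Proof.
have vu : (v == u) = false by rewrite eq_sym (negPf uv).
split=> [cc|[k bc] w]; last first.
  rewrite bdry_contraction !bc !eqxx vu (negPf uv).
  by case: (w == v) (w == u) => [] [] //; ring.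
exists (bdry c u) => w; have := cc w; have := cc u.
rewrite !bdry_contraction eqxx (negPf uv).
case: (eqVneq w v) => [->|wv]; first by rewrite vu => cuv _; move: cuv; lia.
by case: (eqVneq w u) => [->|wu] _; [rewrite subr0 mulr1 | rewrite subrr mulr0].
Qed.

Lemma independent_contraction X : e0 \notin X ->
  @independent (contraction e0) X <-> independent (e0 |: X).
Proof.
move=> e0X; split=> indX phi cphi phiX.
  have phi0 : (fun e => phi e - phi e0 * (e == e0)%:Z) =1 (fun=> 0).
    apply: indX => [|e eX].
      apply/circulation_contraction; exists (- phi e0) => w.
      rewrite bdryD bdryN bdryM bdry_delta cphi !(eq_sym _ w); ring.
    have [->|ne] := eqVneq e e0; first by rewrite mulr1 subrr.
    by rewrite mulr0 subr0 phiX // !inE negb_or ne.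
  have phiE e : phi e = phi e0 * (e == e0)%:Z by apply/eqP; rewrite -subr_eq0 phi0.
  have phi_e0 : phi e0 = 0.
    by have := cphi u; rewrite (eq_bdry phiE) bdryM bdry_delta eqxx eq_sym (negPf uv)
      subr0 mulr1.
  by move=> e; rewrite phiE phi_e0 mul0r.
have [k bk] := (circulation_contraction _).1 cphi.
have phi0 : (fun e => phi e - k * (e == e0)%:Z) =1 (fun=> 0).
  apply: indX => [|e]; first exact: circulation_close.
  by rewrite !inE negb_or => /andP[/negPf-> eX]; rewrite phiX // mulr0 subr0.
have k0 : k = 0.
  by have := phi0 e0; rewrite phiX // eqxx mulr1 sub0r => /eqP; rewrite oppr_eq0 => /eqP.
by move=> e; have := phi0 e; rewrite k0 mul0r subr0.
Qed.

(** Forests avoiding [e0] are those of [A]; removing [e0] from the others gives the forests of the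
    contraction. *)
Lemma card_forests_add A : e0 \notin A ->
  #|forests (e0 |: A)| = (#|forests A| + #|@forests (contraction e0) A|)%N.
Proof.
move=> e0A; rewrite -(cardsID (forests A)); congr (_ + _)%N.
  apply: eq_card => X; rewrite !inE ?powersetE andbC;
    case: (boolP (X \subset A)) => //= XA.
  by rewrite (subset_trans XA) ?subsetUr // andbb.
pose add X := e0 |: X.
have add_inj : {in @forests (contraction e0) A &, injective add}.
  move=> X X'; rewrite !inE ?powersetE => /andP[/subsetP XA _] /andP[/subsetP XA' _] eX.
  rewrite -(setU1K (B := X) (a := e0)) ?(contra (XA _)) // -(setU1K (B := X') (a :=
    e0)) ?(contra (XA' _)) //.
  by rewrite /add in eX; rewrite eX.
rewrite -(card_in_imset add_inj); apply: eq_card => X; rewrite !inE ?powersetE.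
apply/idP/imsetP.
  case/andP=> nXA /andP[XA indX].
  have e0X : e0 \in X.
    apply: contraR nXA => e0X; rewrite indX andbT; apply/subsetP => e eX.
    have := subsetP XA e eX; rewrite inE => /orP[/set1P ee0|//].
    by rewrite -ee0 eX in e0X.
  exists (X :\ e0); last by rewrite /add setD1K.
  rewrite !inE ?powersetE subDset XA /=; apply/asboolP/independent_contraction.
    by rewrite !inE eqxx.
  by rewrite setD1K //; apply/asboolP.
case=> Y; rewrite !inE ?powersetE => /andP[YA /asboolP/independent_contraction indY] ->.
have e0Y : e0 \notin Y by apply: contra e0A; apply: (subsetP YA).
apply/andP; split; last by rewrite /add setUS //=; apply/asboolP/indY.
apply/negP => /andP[/subsetP/(_ e0)]; rewrite /add !inE eqxx => /(_ isT).
by rewrite (negPf e0A).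
Qed.

Let d : {ffun V -> int} := score [set e0].

Lemma score_add U : e0 \notin U -> score (e0 |: U) = score U + d.
Proof.
move=> e0U; apply/ffunP => w; rewrite [RHS]ffunE.
rewrite (scoreE (c := fun e => (e \in U)%:Z + (e \in [set e0])%:Z)) ?bdryD ?ffunE // => e.
by rewrite !inE; case: eqP => [->|_]; rewrite ?(negPf e0U) ?addr0.
Qed.

Lemma edge_scoreE w : d w = (w == u)%:Z - (w == v)%:Z.
Proof.
rewrite (scoreE (c := fun e => (e == e0)%:Z)) => [|e]; last by rewrite inE.
by rewrite bdry_delta !(eq_sym w).
Qed.

Definition merge_score (s : {ffun V -> int}) : {ffun V -> int} :=
  [ffun w => if w == v then 0 else if w == u then s u + s v else s w].

Lemma score_contraction U : @score (contraction e0) U = merge_score (score U).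
Proof. by apply/ffunP => w; rewrite ffunE bdry_contraction ffunE !ffunE. Qed.

Lemma merge_score_eq s s' : merge_score s = merge_score s' -> exists k : int, s' = s +
  d *~ k.
Proof.
have vu : (v == u) = false by rewrite eq_sym (negPf uv).
move=> /ffunP eqm; exists (s' u - s u); apply/ffunP => w.
rewrite ffunE ffunMzE edge_scoreE mulrzz; have := eqm w; have := eqm u.
rewrite !ffunE eqxx (negPf uv).
move=> eq_u; case: (eqVneq w v) => [->|wv] eq_w.
  by rewrite vu sub0r mulN1r opprB addrA [s v + _]addrC eq_u addrAC subrr add0r.
case: (eqVneq w u) eq_w => [-> _|wu ->]; first by rewrite subr0 mul1r addrC subrK.
by rewrite subrr mul0r addr0.
Qed.

Lemma merge_scoreD s k : merge_score (s + d *+ k) = merge_score s.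
Proof.
have vu : (v == u) = false by rewrite eq_sym (negPf uv).
apply/ffunP => w; rewrite !ffunE !ffunMnE !edge_scoreE !eqxx vu (negPf uv).
case: (eqVneq w v) => // wv; case: (eqVneq w u) => wu.
  by rewrite subr0 sub0r mulNrn addrACA subrr addr0.
by rewrite subrr mul0rn addr0.
Qed.

Lemma scores_interval A s k : s \in scores A -> s + d *+ k.+1 \in scores A ->
  s + d \in scores A.
Proof.
case/scoresP=> U UA ->; case/scoresP=> U' U'A /ffunP sU'.
have [|U'' U''A sU''] := score_interval (u := u) (v := v) (k := k) UA U'A.
  by move=> w; rewrite -sU' [LHS]ffunE ffunMnE edge_scoreE -mulr_natl natz.
apply/scoresP; exists U'' => //; apply/ffunP => w.
by rewrite sU'' ffunE edge_scoreE.
Qed.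

(** On each line in the direction [d] the scores of [A] form a segment, so [B], the new scores,
    holds exactly the point just beyond its end. Contraction collapses each line to a point, whence
    [merge_score] maps [B] bijectively onto the contracted scores. *)
Lemma size_scores_add A : e0 \notin A ->
  size (scores (e0 |: A)) = (size (scores A) + size (@scores (contraction e0) A))%N.
Proof.
move=> e0A; pose L := scores A.
have LP s : reflect (exists2 U : {set E}, U \subset A & s = score U) (s \in L) :=
  scoresP A s.
pose B := [seq s <- [seq s + d | s <- L] | s \notin L].
have uniqL : uniq L by apply: undup_uniq.
have uniqB : uniq B by rewrite filter_uniq // map_inj_uniq //; apply: addIr.
have BP s : (s \in B) = (s \notin L) && (s - d \in L).
  rewrite mem_filter; congr (_ && _); apply/mapP/idP => [[s' s'L ->]|sL];
    first by rewrite addrK.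
  by exists (s - d) => //; rewrite subrK.
have -> : size (scores (e0 |: A)) = size (L ++ B).
  apply: perm_size; apply: uniq_perm; first exact: undup_uniq.
    rewrite cat_uniq uniqL uniqB andbT /=; apply/hasPn => s; rewrite BP => /andP[].
    by [].
  move=> s; rewrite mem_cat BP; apply/scoresP/idP => [[U UA ->]|].
    have [e0U|e0U] := boolP (e0 \in U); last first.
      apply/orP; left; apply/LP; exists U => //; apply/subsetP => e eU.
      have := subsetP UA e eU; rewrite inE => /orP[/set1P ee0|//].
      by rewrite -ee0 eU in e0U.
    have UdL : score U - d \in L.
      apply/LP; exists (U :\ e0); first by rewrite subDset.
      by rewrite -{1}(setD1K e0U) score_add ?addrK // !inE eqxx.
    by rewrite UdL andbT orbN.
  case/orP=> [/LP[U UA ->]|/andP[_ /LP[U UA sd]]].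
    by exists U => //; apply: subset_trans UA (subsetUr _ _).
  exists (e0 |: U); first exact: setUS.
  by rewrite score_add -?sd ?subrK //; apply: contra e0A; apply: (subsetP UA).
rewrite size_cat; congr (_ + _)%N; rewrite -(size_map merge_score).
have no_step s (k : nat) : s \in B -> s + d *+ k.+1 \notin B.
  rewrite !BP => /andP[sL sdL]; apply/negP => /andP[_].
  case: k => [|k]; first by rewrite mulr1n addrK (negPf sL).
  have -> : s + d *+ k.+2 - d = (s - d) + d *+ k.+2 by rewrite addrAC.
  by move=> /(scores_interval sdL); rewrite subrK (negPf sL).
apply: perm_size; apply: uniq_perm; last 1 first.
- move=> s; apply/mapP/(@scoresP (contraction e0) A s) => [[s' s'B ->]|[U UA ->]].
    move: s'B; rewrite BP => /andP[_ /LP[U UA s'd]]; exists U => //.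
    by rewrite score_contraction -s'd -(merge_scoreD (s' - d) 1) mulr1n subrK.
  pose s0 := @score G U; have s0L : s0 \in L by apply/LP; exists U.
  (* The finite list [L] cannot contain a whole ray, so the segment through [s0] ends; the least
     such index gives the first point beyond it. *)
  have [n nL] : exists n, s0 + d *+ n.+1 \notin L.
    case: (pselect (exists n, s0 + d *+ n.+1 \notin L)) => // nex.
    have allL n : s0 + d *+ n \in L.
      by case: n => [|n]; [rewrite mulr0n addr0 | apply/negPn/negP => H; apply: nex;
        exists n].
    have uniqM : uniq [seq s0 + d *+ n | n <- iota 0 (size L).+1].
      rewrite map_inj_uniq ?iota_uniq // => m n /addrI /ffunP/(_ u).
      by rewrite !ffunMnE edge_scoreE eqxx (negPf uv) subr0 !pmulrn !intz => -[].
    have : {subset [seq s0 + d *+ n | n <- iota 0 (size L).+1] <= L} by move=> s'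
      /mapP[n _ ->].
    by move=> /(uniq_leq_size uniqM); rewrite size_map size_iota ltnn.
  have [m mL minm] := ex_minnP (ex_intro (fun n => s0 + d *+ n.+1 \notin L) n nL).
  exists (s0 + d *+ m.+1); last by rewrite merge_scoreD score_contraction.
  rewrite BP mL mulrSr addrA addrK /=.
  case: m minm mL => [|m] minm mL; first by rewrite mulr0n addr0.
  by apply/negPn/negP => /minm; rewrite ltnn.
- rewrite map_inj_in_uniq // => s s' sB s'B /merge_score_eq[[k|k] sE].
    case: k sE => [|k] sE; first by rewrite sE mulr0z addr0.
    by move: sE; rewrite -pmulrn => sE; have := no_step s k sB; rewrite -sE s'B.
  have s'E : s = s' + d *+ k.+1 by rewrite sE NegzE mulrNz -pmulrn subrK.
  by have := no_step s' k s'B; rewrite -s'E sB.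
exact: undup_uniq.
Qed.

End Contract.

Lemma scores_loop (G : multigraph) (e0 : edge G) (A : {set edge G}) : src e0 = dst e0
  -> scores (e0 |: A) =i scores A.
Proof.
move=> loop s; apply/scoresP/scoresP => -[U UA ->]; last first.
  by exists U => //; apply: subset_trans UA (subsetUr _ _).
exists (U :\ e0); first by rewrite subDset.
apply/ffunP => w; rewrite [RHS](scoreE (c := fun e => (e \in U)%:Z - (e0 \in U)%:Z * (e
  == e0)%:Z)).
  by rewrite bdryD bdryN bdryM bdry_delta loop subrr mulr0 subr0 ffunE.
move=> e; rewrite !inE; case: eqVneq => [->|_]; first by rewrite mulr1 subrr.
by rewrite mulr0 subr0.
Qed.

Lemma forests_loop (G : multigraph) (e0 : edge G) (A : {set edge G}) : e0 \notin A ->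
  src e0 = dst e0 -> forests (e0 |: A) = forests A.
Proof.
move=> e0A loop; apply/setP => X; rewrite !inE ?powersetE.
apply/andP/andP => -[XA /asboolP indX]; split; try exact/asboolP; last first.
  by apply: subset_trans XA (subsetUr _ _).
apply/subsetP => e eX; have := subsetP XA e eX; rewrite inE => /orP[/set1P ee0|//].
have : (fun e => (e == e0)%:Z) =1 (fun=> 0 : int).
  apply: indX => [w|e' e'X]; first by rewrite bdry_delta loop subrr.
  by case: eqP => // ee'; rewrite ee' -ee0 eX in e'X.
by move/(_ e0); rewrite eqxx.
Qed.

(* Deletion-contraction: the scores of A + e0 form lines in the direction of e0,
   and those not already scores of A are one per line. *)
Theorem size_scores (G : multigraph) (A : {set edge G}) : size (scores A) = #|forests A|.
Proof.
(* Contraction changes only the incidence map, so the induction on [A] is carried out for all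
   incidence maps at once. *)
suff: forall en, size (@scores (@Multigraph (vertex G) (edge G) en) A) = #|@forests
  (@Multigraph (vertex G) (edge G) en) A|.
  by case: G A => V E en A; apply.
elim/edge_set_ind: A => [|e0 A e0A IH] en; set H := Multigraph en.
  have -> : size (@scores H set0) = 1%N.
    by rewrite /scores powerset0 enum_set1.
  apply/esym/eqP/cards1P; exists set0; apply/setP => X; rewrite !inE ?powersetE subset0.
  case: eqP => //= ->; apply/asboolP => phi _ phi0 e; apply: phi0; by rewrite inE.
have [loop|uv] := eqVneq (@src H e0) (@dst H e0).
  rewrite forests_loop // -IH; apply: perm_size; apply: uniq_perm; rewrite ?undup_uniq //.
  exact: scores_loop.
by rewrite size_scores_add // card_forests_add // !IH.
Qed.

(** * The case q = 0 *)

Section Forests.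
Variable G : multigraph.
Local Notation V := (vertex G).
Local Notation E := (edge G).
Implicit Types (X Y U : {set E}) (rho : orientation G).

Lemma independentP X : independent X <-> nullity X = 0%N.
Proof.
split.
  elim/edge_set_ind: X => [|e0 Y e0Y IH] indX; first by rewrite /nullity cards0.
  have [[gamma [cg g1 gY _]]|[R [_ _ _ rE]]] := rank_add e0Y.
    by have := indX gamma cg gY e0; rewrite g1.
  rewrite /nullity rE cardsU1 e0Y subSS; apply: IH => phi cphi phiY;
    apply: indX => // e eX.
  by apply: phiY; apply: contra eX; rewrite inE orbC => ->.
move=> nX phi cphi phiX e0; have [e0X|/phiX//] := boolP (e0 \in X).
have e0Y : e0 \notin X :\ e0 by rewrite !inE eqxx.
rewrite -(setD1K e0X) in nX phiX.
have [[gamma [cg g1 gY rE]]|[R [dR sR YR _]]] := rank_add e0Y.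
  by move: nX; rewrite /nullity rE cardsU1 e0Y subSn // rank_le_card.
apply/eqP; rewrite -oppr_eq0 -(bdry_cut dR sR YR phiX) big1 // => v _; exact: cphi.
Qed.

Lemma signed_ord1 rho (g : {ffun E -> 'I_1}) e : signed rho g e = 0.
Proof. by rewrite /signed (ord1 (g e)) mulr0. Qed.

Definition residues p (t : orientation G * ({ffun E -> 'I_p.+2} * {ffun E -> 'I_1})) :
    {ffun E -> 'I_p.+1} := [ffun e => residue p (signed t.1 t.2.1 e)].

(** With all flows zero, the mark is taken with second modulus 1 and value 0: it singles out the
    edges where $x_\rho-f/p$ equals 1. *)
Definition marked_edges p (t : orientation G * ({ffun E -> 'I_p.+2} * {ffun E -> 'I_1})) :
    {set E} := [set e | marked p.+1%:Z 1 (fwd t.1 e) (signed t.1 t.2.1 e) 0].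

Lemma conformal_signed0 rho p (f : {ffun E -> 'I_p.+1}) e :
  conformal p%:Z 1 (fwd rho e) (signed rho f e) 0.
Proof.
have x01 : 0 <= fwd rho e <= 1 by rewrite /fwd; case: (rho e).
by split=> //; [exact: signed_range | exact: cube_range0 | rewrite mulr0].
Qed.

Lemma conformal_mul1 p (x a z : int) : 0 < p -> conformal p 1 x (p * a) z ->
  [/\ x - 1 <= a <= x, x - 1 <= z <= x & a * z = 0].
Proof. by move=> p0; rewrite -{1}(mul1r z) => /(conformal_mul p0 ltr01). Qed.

Lemma marked_mul1 p (x a z : int) : 0 < p -> marked p 1 x (p * a) z = (x - a - z == 1).
Proof. by move=> p0; rewrite -{1}(mul1r z) marked_mul. Qed.

Section Fibre.
Variables (T : {set orientation G}) (p : nat) (f : {ffun E -> 'I_p.+1}).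
Hypotheses (hT : ce_representatives T) (pf : potential f).

Let D := [set t in tension_flow_triples T p.+1 0 | residues t == f].
Let Z := [set e | f e == 0].

(** On each edge $x_\rho-f/p$ is the mark plus a fraction fixed by the residue. Hence triples with
    equal residues and equal scores have marks that differ by a circulation and lie in one coset. *)
Lemma fibre_diff t1 t2 (u : E -> int) e :
    signed t1.1 t1.2.1 e - signed t2.1 t2.2.1 e = p.+1%:Z * u e ->
  fwd t1.1 e - fwd t2.1 e =
    u e + ((e \in @marked_edges p t1)%:Z - (e \in @marked_edges p t2)%:Z).
Proof.
move=> eu; rewrite !inE.
have c1 := conformal_signed0 t1.1 t1.2.1 e; have c2 := conformal_signed0 t2.1 t2.2.1 e.
have [/dvdzP[a y1E]|nd1] := boolP (p.+1%:Z %| signed t1.1 t1.2.1 e)%Z.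
  rewrite mulrC in y1E.
  have y2E : signed t2.1 t2.2.1 e = p.+1%:Z * (a - u e) by rewrite mulrBr -y1E -eu; ring.
  move: c1 c2; rewrite y1E y2E !marked_mul1 // => /(conformal_mul1 (ltz0S p))[? _ _]
    /(conformal_mul1 (ltz0S p))[? _ _].
  lia.
have nd2 : ~~ (p.+1%:Z %| signed t2.1 t2.2.1 e)%Z.
  apply: contra nd1 => d2; have -> : signed t1.1 t1.2.1 e = p.+1%:Z * u e + signed t2.1
    t2.2.1 e by rewrite -eu subrK.
  by apply: rpredD => //; apply: dvdz_mulr.
have nm t : ~~ (p.+1%:Z %| signed t.1 t.2.1 e)%Z -> conformal p.+1%:Z 1 (fwd t.1 e)
  (@signed G p.+2 t.1 t.2.1 e) 0 ->
    marked p.+1%:Z 1 (fwd t.1 e) (@signed G p.+2 t.1 t.2.1 e) 0 = false.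
  move=> nd c; apply: contraNF nd => m.
  by have /andP[] := marked_dvd (ltz0S p) ltr01 c m.
rewrite !nm // subrr addr0.
have [_ b1 _ _] := c1; have [_ b2 _ _] := c2.
exact: (nondvd_diff (ltz0S p) b1 b2 eu nd1).
Qed.

Lemma fibre_inj : {in D &, injective (fun t => score (marked_edges t))}.
Proof.
move=> t1 t2 /setIdP[in1 /eqP r1] /setIdP[in2 /eqP r2] /ffunP sc.
have [u eu] := residue_diff (etrans r1 (esym r2)).
apply: (@tension_flow_eq G T _ _ t1 t2 u
  (fun e => (e \in marked_edges t1)%:Z - (e \in marked_edges t2)%:Z) p.+1%:Z 1) => //
    [e|v|e _].
- exact: fibre_diff.
- by have := sc v; rewrite bdryD bdryN !ffunE => ->; rewrite subrr.
- by rewrite !signed_ord1 subrr.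
Qed.

Lemma fibre_scores : [seq score (marked_edges t) | t <- enum D] =i scores Z.
Proof.
move=> s; apply/mapP/scoresP => [[t]|[U UZ ->]].
  rewrite mem_enum => /setIdP[_ /eqP/ffunP rt] ->; exists (marked_edges t) => //.
  apply/subsetP => e; rewrite !inE => m; rewrite -rt ffunE residue_eq0.
  by have /andP[] := marked_dvd (ltz0S p) ltr01 (conformal_signed0 t.1 t.2.1 e) m.
have [f0 pf0 f0f] := potential_lift pf.
have fU e : e \in U -> f e = 0 by move/(subsetP UZ); rewrite inE => /eqP.
(* The second modulus is 1, so the lift only prescribes [U] up to a circulation [z]. This [z] is not
   the flow of the triple, which is 0: it is the difference between the marks and [U], and does not
   affect the score. *)
have [||||e eX||rho [y [z [rhoT py cz yzP]]]] :=
    @representative_lift G T p.+1%:Z 1 U f0 (fun=> 0) hT => //.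
  by move=> v; exact: bdry0.
  by rewrite -residue_eq0 f0f fU.
have yE : forall e, signed rho (unsign p.+1 rho y) e = y e.
  by apply: signed_unsign => e; have [_ _ []] := yzP e.
have ry e : residue p (y e) = f e.
  by rewrite -f0f; apply/eqP; rewrite residue_eq; have [] := yzP e.
pose t : orientation G * ({ffun E -> 'I_p.+2} * {ffun E -> 'I_1}) :=
  (rho, (unsign p.+1 rho y, [ffun=> ord0])).
exists t.
  rewrite mem_enum; apply/setIdP; split.
    apply/triplesP; split=> //=; apply/tension_flowP; split.
      by apply: eq_potential py => e; rewrite yE.
    by move=> v; rewrite (eq_bdry (d := fun=> 0)) ?bdry0 // => e; rewrite signed_ord1.
  by apply/eqP/ffunP => e; rewrite ffunE yE ry.
have markedE e : (e \in marked_edges t)%:Z = (e \in U)%:Z + z e.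
  have [_ _ c ->] := yzP e; rewrite inE /= yE dvd1z /=.
  have [/dvdzP[a yaE]|nd] := boolP (p.+1%:Z %| y e)%Z.
    rewrite mulrC in yaE; move: c; rewrite yaE !marked_mul1 // => /(conformal_mul1
      (ltz0S p))[? ? /eqP].
    by rewrite mulf_eq0; lia.
  have z0 : z e = 0.
    by have [_ _ _ /eqP] := c; rewrite mulf_eq0 => /orP[/eqP y0|/eqP//];
      rewrite y0 dvdz0 in nd.
  rewrite z0 addr0 in c *; congr (Posz _).
apply/ffunP => v; rewrite [RHS](scoreE (c := fun e => (e \in U)%:Z + z e)) => [|e];
  last by rewrite markedE.
by rewrite bdryD cz addr0 ffunE.
Qed.

Lemma card_fibre : #|D| = #|forests Z|.
Proof.
rewrite -size_scores cardE -(size_map (fun t => score (marked_edges t))).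
apply: perm_size; apply: uniq_perm; [|exact: undup_uniq|exact: fibre_scores].
rewrite map_inj_in_uniq ?enum_uniq // => t1 t2; rewrite !mem_enum; exact: fibre_inj.
Qed.

End Fibre.

(** Over each residue tension the triples are counted by the forests in its zero set. Exchanging the
    sums counts, for each forest, the potentials vanishing on it; the factor [0 ^ nullity X] selects
    the forests. *)
Theorem kappa_bar_flow0 (T : {set orientation G}) p : ce_representatives T ->
  kappa_bar T p.+1 0 =
    (\sum_(X : {set E}) p.+1 ^ (rank [set: E] - rank X) * 0 ^ nullity X)%N.
Proof.
move=> hT; rewrite -card_tension_flow_triples -sum1_card.
rewrite (partition_big (@residues p) (mem (potentials 'I_p.+1 set0))) /=; last first.
  move=> t /triplesP[_ /tension_flowP[pf _]]; apply/potentialsP; split=> [|e];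
    last by rewrite inE.
  by apply: eq_potential (potential_mulrz (inZp 1) pf) => e; rewrite ffunE.
transitivity (\sum_(f in potentials 'I_p.+1 set0) \sum_(X : {set E} | (X \subset [set e
  | f e == 0%R]) && `[< independent X >]) 1)%N.
  apply: eq_bigr => f /potentialsP[pf _].
  rewrite sum1_card (eq_card (B := [set t in tension_flow_triples T p.+1 0 | residues t
    == f])) => [|t]; last by rewrite [RHS]inE.
  by rewrite (card_fibre hT pf) -sum1_card; apply: eq_bigl => X; rewrite !inE.
under eq_bigr do rewrite big_mkcond.
rewrite exchange_big /=; apply: eq_bigr => X _.
have -> : (0 ^ nullity X)%N = `[< independent X >].
  case: asboolP => [/independentP->//|nind]; rewrite exp0n // lt0n.
  by apply/eqP => /independentP.
case: asboolP => ind; last by rewrite muln0 big1 // => f _; rewrite andbF.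
rewrite muln1 -[in RHS](card_ord p.+1) -card_potentials -sum1_card -big_mkcondr /=.
apply: eq_bigl => f; rewrite andbT; apply/andP/potentialsP => [[/potentialsP[pf _]
  /subsetP fX]|[pf fX]].
  by split=> // e /fX; rewrite inE => /eqP.
by split; [apply/potentialsP; split=> // e; rewrite inE | apply/subsetP => e /fX;
  rewrite inE => ->].
Qed.

End Forests.

(** * Polynomiality and the case p = 0 *)

Lemma poly_nat_roots (F : idomainType) (K : {poly F}) (m : nat) :
    injective (fun n => n%:R : F) -> (forall n, (m <= n)%N -> K.[n%:R] = 0) -> K = 0.
Proof.
move=> inj K0; apply: (@roots_geq_poly_eq0 _ _ [seq n%:R | n <- iota m (size K)]).
- by apply/allP => _ /mapP[n nm ->]; apply/eqP/K0; move: nm; rewrite mem_iota => /andP[].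
- by rewrite map_inj_uniq ?iota_uniq.
- by rewrite size_map size_iota.
Qed.

Definition binomial_poly k : {poly rat} := (k`!)%:R^-1 *: \prod_(i < k) ('X - i%:R%:P).

Lemma binomial_polyE k n : (binomial_poly k).[n%:R] = 'C(n, k)%:R.
Proof.
rewrite hornerZ horner_prod; under eq_bigr do rewrite hornerXsubC.
have k0 : (k`!)%:R != 0 :> rat by rewrite pnatr_eq0 -lt0n fact_gt0.
apply: (mulfI k0); rewrite mulrA mulfV // mul1r -natrM mulnC bin_ffact.
have [kn|nk] := leqP k n; last first.
  by rewrite ffact_small // (bigD1 (Ordinal nk)) //= subrr mul0r.
rewrite ffact_prod natr_prod; apply: eq_bigr => i _.
by rewrite natrB // ltnW // (leq_trans (ltn_ord i)).
Qed.

(** * Vertex labellings counted by order pattern *)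

Section Patterns.
Variables (V E : finType) (t h : E -> V) (P : pred {ffun E -> bool}).

Definition pattern N (b : {ffun V -> 'I_N}) : {ffun E -> bool} := [ffun e => (b (t e) <
  b (h e))%N].

Definition onto_patterns N : {set {ffun V -> 'I_N}} :=
  [set b : {ffun V -> 'I_N} | (b @: [set: V] == setT) && P (pattern b)].

Lemma card_patterns_image N (I : {set 'I_N}) :
  #|[set b : {ffun V -> 'I_N} | P (pattern b) & b @: [set: V] == I]| = #|onto_patterns
    #|I| |.
Proof.
pose m (c : {ffun V -> 'I_#|I|}) : {ffun V -> 'I_N} := [ffun v => Order.enum_val (c v)].
have m_inj : injective m.
  by move=> c c' /ffunP cc; apply/ffunP => v; have := cc v;
    rewrite !ffunE => /Order.enum_val_inj.
have m_pat c : pattern (m c) = pattern c.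
  apply/ffunP => e; rewrite !ffunE !ltnNge; congr negb.
  exact: (@Order.le_enum_val _ 'I_N (@le_total _ _) (mem I)).
rewrite -(card_imset _ m_inj); apply: eq_card => b; rewrite inE.
apply/andP/imsetP => [[Pb /eqP bI]|[c]].
  have bvI v : b v \in I by rewrite -bI imset_f.
  pose c := [ffun v => Order.enum_rank_in (bvI v) (b v)].
  have bE : b = m c by apply/ffunP => v; rewrite !ffunE Order.enum_rankK_in.
  exists c => //; rewrite inE -m_pat -bE Pb andbT eqEsubset subsetT /=.
  apply/subsetP => a _; have /imsetP[v _ av] : Order.enum_val a \in b @: [set: V].
    by rewrite bI; apply: Order.enum_valP.
  by apply/imsetP; exists v => //; apply: Order.enum_val_inj; rewrite av {1}bE ffunE.
rewrite inE => /andP[/eqP cT Pc] ->; rewrite m_pat; split=> //.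
apply/eqP/setP => x; apply/imsetP/idP => [[v _ ->]|xI].
  by rewrite ffunE; apply: Order.enum_valP.
have /imsetP[v _ vE] : Order.enum_rank_in xI x \in c @: [set: V] by rewrite cT inE.
by exists v => //; rewrite ffunE -vE Order.enum_rankK_in.
Qed.

(** Labellings are grouped by image. Relabelling in increasing order preserves patterns, so an image
    of size [k] contributes the number of onto labellings with [k] labels, and there are ['C(N, k)]
    such images, with [k] at most [#|V|]. *)
Lemma card_patterns : exists Q : {poly rat}, forall N,
  #|[set b : {ffun V -> 'I_N} | P (pattern b)]|%:R = Q.[N%:R].
Proof.
exists (\sum_(k < #|V|.+1) #|onto_patterns k|%:R *: binomial_poly k) => N.
rewrite horner_sum; under eq_bigr do rewrite hornerZ binomial_polyE -natrM.
rewrite -natr_sum; congr _%:R.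
rewrite -sum1_card (partition_big (fun b : {ffun V -> 'I_N} => b @: [set: V]) predT) //=.
transitivity (\sum_(I : {set 'I_N}) #|onto_patterns #|I| |)%N.
  apply: eq_bigr => I _; rewrite sum1_card -card_patterns_image.
  by apply: eq_card => b; rewrite [RHS]inE -topredE /= inE.
have onto0 k : (#|V| < k)%N -> #|onto_patterns k| = 0%N.
  move=> Vk; apply: eq_card0 => b; rewrite inE; apply/negP => /andP[/eqP bT _].
  by have := leq_imset_card b setT; rewrite bT !cardsT card_ord leqNgt Vk.
rewrite (bigID (fun I : {set 'I_N} => (#|I| < #|V|.+1)%N)) /= addnC big1 ?add0n;
  last first.
  by move=> I; rewrite -leqNgt; apply: onto0.
rewrite (partition_big (fun I : {set 'I_N} => inord #|I| : 'I_#|V|.+1) predT) //=.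
apply: eq_bigr => k _; rewrite mulnC -[N in 'C(N, _)]card_ord -card_draws -sum_nat_const.
apply: eq_big => [I|I /andP[IV /eqP <-]]; last by rewrite inordK.
rewrite inE; apply/andP/eqP => [[IV /eqP <-]|->]; first by rewrite inordK.
by rewrite ltn_ord inord_val.
Qed.

End Patterns.

Lemma val_Zp_sub n (a b : 'I_n.+1) :
  ((a - b)%R : nat)%:Z = (a : nat)%:Z - (b : nat)%:Z + n.+1%:Z * (a < b)%N%:Z.
Proof.
rewrite /= modnDmr; have an := ltn_ord a; have bn := ltn_ord b.
have [ab|ba] := ltnP a b; first by rewrite modn_small; lia.
by rewrite addnBA ?(ltnW bn) // addnC -addnBA // modnDl modn_small; lia.
Qed.

(** * Bounded tensions as differences of labellings *)

Section Polynomiality.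
Variable G : multigraph.
Local Notation V := (vertex G).
Local Notation E := (edge G).
Implicit Types (rho : orientation G).

Definition bounded_tensions rho p : {set {ffun E -> 'I_p.+1}} :=
  [set f | `[< tension rho (int_of_bounded f) >]].

Definition bounded_flows rho q : {set {ffun E -> 'I_q.+1}} :=
  [set g | `[< flow rho (int_of_bounded g) >]].

Lemma kappaE rho p q : kappa rho p q = (#|bounded_tensions rho p| * #|bounded_flows rho
  q|)%N.
Proof.
rewrite -cardsX; apply: eq_card => -[f g]; rewrite in_setX !inE.
by apply/asboolP/andP => [[tf ff]|[/asboolP tf /asboolP ff]]; split=> //; exact/asboolP.
Qed.

Definition tension_pattern rho (d : {ffun E -> bool}) : bool :=
  `[< tension rho (fun e => (d e)%:Z) >].

(** The difference modulo [p.+1] is the integral difference plus [p.+1] on the edges where the label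
    rises. It is thus an integral tension exactly when the indicator of those edges is one, a
    condition on the order pattern alone. *)
Lemma tension_ord_sub rho p (b : {ffun V -> 'I_p.+1}) :
  ([ffun e => b (tail rho e) - b (head rho e)] \in bounded_tensions rho p) =
  tension_pattern rho (pattern (tail rho) (head rho) b).
Proof.
rewrite inE; pose fb e := p.+1%:Z * (b (tail rho e) < b (head rho e))%N%:Z.
have fE e : int_of_bounded [ffun e => b (tail rho e) - b (head rho e)] e =
    (b (tail rho e) : nat)%:Z - (b (head rho e) : nat)%:Z + fb e.
  by rewrite /int_of_bounded ffunE val_Zp_sub.
apply/asboolP/asboolP => [[h hE]|[h hE]].
  suff /tensionP pfb : tension rho fb.
    apply/tensionP; apply: (@potential_div _ p.+1%:Z) => //.
    by apply: eq_potential pfb => e; rewrite /fb ffunE mulrCA.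
  exists (fun v => h v - (b v : nat)%:Z) => e; have := hE e; rewrite fE; lia.
exists (fun v => (b v : nat)%:Z + p.+1%:Z * h v) => e; rewrite fE /fb.
have := hE e; rewrite ffunE => ->; ring.
Qed.

Lemma card_tension_patterns rho p :
  #|[set b : {ffun V -> 'I_p.+1} | tension_pattern rho (pattern (tail rho) (head rho)
    b)]| =
  (#|bounded_tensions rho p| * p.+1 ^ ncomp [set: E])%N.
Proof.
(* [s] passes between the direction of [rho] and the reference direction, in which [cobdryf] is
   expressed. *)
pose s (f : {ffun E -> 'I_p.+1}) : {ffun E -> 'I_p.+1} := [ffun e => f e *~ sgo rho e].
have sK : involutive s.
  move=> f; apply/ffunP => e; rewrite !ffunE -mulrzA /sgo.
  by case: (rho e); rewrite ?mulrNN mulr1 mulr1z.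
have s_inj := inv_inj sK.
have := @card_cobdryf_preim G 'I_p.+1 (s @: bounded_tensions rho p).
rewrite card_ord (card_imset _ s_inj) => <-.
  apply: eq_card => b; rewrite !inE -tension_ord_sub.
  have -> : cobdryf b = s [ffun e => b (tail rho e) - b (head rho e)].
    apply/ffunP => e; rewrite !ffunE sgo_cobdry -mulrzA /sgo.
    by case: (rho e); rewrite ?mulrNN mulr1 mulr1z.
  by rewrite (mem_imset _ _ s_inj).
move=> g /imsetP[f]; rewrite inE => /asboolP[h hE] ->.
apply/imsetP; exists [ffun v => residue p (h v)] => //; apply/ffunP => e.
rewrite !ffunE /cobdry !ffunE /residue -mulrzBr -/(cobdry h e) -/(residue _ _).
rewrite -[f e]residue_ord /residue -mulrzA; congr (_ *~ _).
have := hE e; rewrite /int_of_bounded sgo_cobdry mulrzz => ->.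
by rewrite [LHS]mulrC [cobdry h e * _]mulrC sgoK.
Qed.

Definition rank_sum (p q : nat) : nat :=
  (\sum_(X : {set E}) p ^ (rank [set: E] - rank X) * q ^ nullity X)%N.

Lemma kappa_bar_rank_sumS (T : {set orientation G}) p q :
  ce_representatives T -> kappa_bar T p.+1 q = rank_sum p.+1 q.
Proof.
by move=> hT; case: q => [|q]; [apply: kappa_bar_flow0 | apply: kappa_bar_pos].
Qed.

(* (p+1)^c kappa_bar(p,q) counts vertex labellings by their order pattern, hence
   is polynomial in p + 1: the identity for p > 0 extends to p = 0. *)
Lemma kappa_bar_rank_sum (T : {set orientation G}) p q :
  ce_representatives T -> kappa_bar T p q = rank_sum p q.
Proof.
move=> hT; case: p => [|p]; last exact: kappa_bar_rank_sumS.
have /choice[Q QE] rho : exists Q : {poly rat}, forall p,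
    (#|bounded_tensions rho p| * p.+1 ^ ncomp [set: E])%:R = Q.[p.+1%:R].
  have [Q QE] := card_patterns (tail rho) (head rho) (tension_pattern rho).
  by exists Q => p; rewrite -card_tension_patterns.
pose W := \sum_(rho in T) #|bounded_flows rho q|%:R *: Q rho.
(* The variable stands for [p.+1], hence the base ['X - 1%:P] in place of [p]. *)
pose R : {poly rat} := 'X ^+ ncomp [set: E] *
  \sum_(X : {set E}) (q ^ nullity X)%:R *: ('X - 1%:P) ^+ (rank [set: E] - rank X).
have WE p : W.[p.+1%:R] = (p.+1 ^ ncomp [set: E] * kappa_bar T p q)%:R.
  rewrite horner_sum /kappa_bar big_distrr /= natr_sum; apply: eq_bigr => rho _.
  by rewrite hornerZ -QE -natrM kappaE mulnC -mulnA mulnCA.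
have RE p : R.[p.+1%:R] = (p.+1 ^ ncomp [set: E] * rank_sum p q)%:R.
  rewrite hornerM hornerXn natrM natrX; congr (_ * _).
  rewrite horner_sum natr_sum; apply: eq_bigr => X _.
  rewrite hornerZ horner_exp hornerXsubC -natr1 addrK.
  by rewrite natrM [RHS]mulrC !natrX.
(* The two sides agree at all integers from 2 on, that is for positive [p]. Evaluating at 1 then
   gives the case of 0, where the power of [p.+1] is 1. *)
have RW : R - W = 0.
  apply: (@poly_nat_roots _ _ 2) => [m n /eqP|[|[|n]] // _];
    first by rewrite eqr_nat => /eqP.
  by rewrite hornerD hornerN RE WE kappa_bar_rank_sumS // subrr.
have := RE 0%N; rewrite (subr0_eq RW) WE !exp1n !mul1n => /eqP.
by rewrite eqr_nat => /eqP.
Qed.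

Lemma rank_poly_eval p q : (rank_poly G).[p%:R, q%:R] = (rank_sum p q)%:R.
Proof.
rewrite /rank_poly !horner_sum natr_sum; apply: eq_bigr => X _.
by rewrite hornerM hornerXn horner_exp hornerC -rmorphXn /= hornerM hornerC hornerXn
  natrM !natrX.
Qed.

Lemma bivariate_poly_eq (K L : {poly {poly rat}}) :
  (forall p q : nat, K.[p%:R, q%:R] = L.[p%:R, q%:R]) -> K = L.
Proof.
move=> KL; apply/subr0_eq/(@poly_nat_roots _ _ 0) => [m n|p _].
  by move/(congr1 (fun u => u.[0])); rewrite !hornerMn !hornerC => /eqP;
    rewrite eqr_nat => /eqP.
apply: (@poly_nat_roots _ _ 0) => [m n /eqP|q _]; first by rewrite eqr_nat => /eqP.
by rewrite !(hornerD, hornerN) -polyC_natr KL subrr.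
Qed.

End Polynomiality.

Unset Implicit Arguments.

Theorem theorem1p3 (G : multigraph) (T : {set orientation G})
    (hT : ce_representatives T) :
  (forall K : {poly {poly rat}},
     (forall p q : nat, K.[p%:R, q%:R] = (kappa_bar T p q)%:R) <->
     K = rank_poly G) /\
  (forall p q : nat,
     (rank_poly G).[p%:R, q%:R] = #|tension_flow_triples T p q|%:R).
Proof.
have RE p q : (rank_poly G).[p%:R, q%:R] = (kappa_bar T p q)%:R.
  by rewrite rank_poly_eval kappa_bar_rank_sum.
split=> [K|p q]; last by rewrite RE card_tension_flow_triples.
split=> [KE|->//]; by apply: bivariate_poly_eq => p q; rewrite KE RE.
Qed.
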